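(* Let $n\ge2$, $d\ge1$, and let $\delta\in(0,\delta_0)$. Then: 1) $S^{(n-1)d-1}\setminus\Delta$ is homeomorphic to $\partial\,\Xi^{(\delta)}_{\mathcal C_{\min}}$; 2) $\partial\,\Xi^{(\delta)}_{\mathcal C_{\min}}$ is homeomorphic to $\partial\mathbf M_\Delta$.
   Context: $N=\{1,\dots,n\}$, masses $m_i>0$, $M=\{q\in(\mathbb R^d)^n\mid\sum_i m_iq_i=0\}$ with mass inner product $\langle q,q'\rangle_{\mathcal M}=\sum_i m_i\,q_i\cdot q'_i$ and norm $\|\cdot\|_{\mathcal M}$. $S^{(n-1)d-1}=\{q\in M\mid \|q\|_{\mathcal M}=1\}$. $\Delta=\{q\in M\mid q_i=q_j\text{ for some }i\ne j\}$, $\widehat M=M\setminus\Delta$. $\mathcal P(N)$ is the set of set partitions of $N$, $|\mathcal C|$ is the number of blocks of $\mathcal C$, $\mathcal C\preccurlyeq\mathcal D$ means every block of $\mathcal C$ is contained in a block of $\mathcal D$; $\mathcal C_{\min}=\{\{1\},\dots,\{n\}\}$; $\mathcal P_\Delta(N)=\mathcal P(N)\setminus\{\mathcal C_{\min}\}$. $\Delta^E_{\mathcal C}=\{q\in M\mid q_i=q_j\text{ if }i,j\text{ are in the same block of }\mathcal C\}$, $\Delta^I_{\mathcal C}$ is its $\langle\cdot,\cdot\rangle_{\mathcal M}$-orthogonal complement in $M$; $q^E_{\mathcal C},q^I_{\mathcal C}$ are the orthogonal projections of $q$ to $\Delta^E_{\mathcal C}$, $\Delta^I_{\mathcal C}$;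 $J^E_{\mathcal C}(q)=\|q^E_{\mathcal C}\|_{\mathcal M}^2$; $S^I_{\mathcal C}$ is the unit sphere in $\Delta^I_{\mathcal C}$. Graf partition: for $\delta\in(0,1)$, $J^{(\delta)}(q)=\max\{J^E_{\mathcal C}(q)+\delta^{|\mathcal C|}\mid\mathcal C\in\mathcal P(N)\}$ and $\Xi^{(\delta)}_{\mathcal C}=\{q\in M\mid J^E_{\mathcal C}(q)+\delta^{|\mathcal C|}=J^{(\delta)}(q)\}$. $\partial\,\Xi^{(\delta)}_{\mathcal C_{\min}}$ is the topological boundary in $M$. $\delta_0\in(0,1)$ is a constant (it exists) such that for all $\delta\in(0,\delta_0]$: whenever $\Xi^{(\delta)}_{\mathcal C}\cap\Xi^{(\delta)}_{\mathcal D}\ne\emptyset$, then $\mathcal C\preccurlyeq\mathcal D$ or $\mathcal D\preccurlyeq\mathcal C$. Blow-up: for $\mathcal C\in\mathcal P_\Delta(N)$ let $[M:\Delta^E_{\mathcal C}]=\Delta^E_{\mathcal C}\times[0,\infty)\times S^I_{\mathcal C}$, containing $M\setminus\Delta^E_{\mathcal C}$ via $q\mapsto(q^E_{\mathcal C},\|q^I_{\mathcal C}\|_{\mathcal M},q^I_{\mathcal C}/\|q^I_{\mathcal C}\|_{\mathcal M})$. $\mathbf M_\Delta$ is the closure of the image of the diagonal map $\widehat M\to\prod_{\mathcal C\in\mathcal P_\Delta(N)}[M:\Delta^E_{\mathcal C}]$, $q\mapsto(q)_{\mathcal C}$. It is a manifold with corners with interior (the image of) $\widehat M$, and $\partial\mathbf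 M_\Delta=\mathbf M_\Delta\setminus\widehat M$ is its boundary. *)

(* Defs.v *)
From mathcomp Require Import all_boot all_order all_algebra.
From mathcomp Require Import boolp classical_sets functions reals topology.
From mathcomp Require Import normedtype.

Set Implicit Arguments.
Unset Strict Implicit.
Unset Printing Implicit Defensive.

Import Order.TTheory GRing.Theory Num.Theory.
Import numFieldNormedType.Exports.

Local Open Scope ring_scope.

(* The index set {1, ..., n} is 'I_n; P(N) is the boolean predicate is_part. *)
Definition is_part (n : nat) (C : {set {set 'I_n}}) : bool :=
  finset.partition C [set: 'I_n]%SET.

Definition Cmin (n : nat) : {set {set 'I_n}} :=
  [set [set i]%SET | i : 'I_n]%SET.

Definition finer (n : nat) (C D : {set {set 'I_n}}) : bool :=
  [forall B in C, exists B' in D, B \subset B'].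

Definition PDelta (n : nat) : Type :=
  {C : {set {set 'I_n}} | is_part C && (C != Cmin n)}.

Local Open Scope classical_set_scope.

Definition homeomorphic (T U : topologicalType) (A : set T) (B : set U) : Prop :=
  exists (f : T -> U) (g : U -> T),
    (forall x, A x -> B (f x) /\ g (f x) = x) /\
    (forall y, B y -> A (g y) /\ f (g y) = y) /\
    {within A, continuous f} /\ {within B, continuous g}.

Definition boundary (T : topologicalType) (X : set T) : set T :=
  closure X `\` interior X.

Section Configurations.
Variables (R : realType) (n d : nat) (m : 'I_n -> R).

(* q = (q_1, ..., q_n) in (R^d)^n is the matrix with rows q_i. *)
Local Notation conf := 'M[R]_(n, d).

Definition mdot (q q' : conf) : R :=
  \sum_(i < n) m i * \sum_(k < d) q i k * q' i k.

Definition mnorm (q : conf) : R := Num.sqrt (mdot q q).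

Definition Mspace : set conf := [set q | \sum_(i < n) m i *: row i q = 0].

Definition Msphere : set conf := Mspace `&` [set q | mnorm q = 1].

Definition Delta : set conf :=
  Mspace `&` [set q | exists i j, i <> j /\ row i q = row j q].

Definition Mhat : set conf := Mspace `\` Delta.

Definition DeltaE (C : {set {set 'I_n}}) : set conf :=
  Mspace `&` [set q | forall B i j,
    B \in C -> i \in B -> j \in B -> row i q = row j q].

Definition DeltaI (C : {set {set 'I_n}}) : set conf :=
  Mspace `&` [set q | forall p, DeltaE C p -> mdot q p = 0].

(* The default value 0 is never used when V is a linear subspace and m > 0:
   then exactly one p satisfies the condition. *)
Definition mproj (V : set conf) (q : conf) : conf :=
  xget 0 [set p | V p /\ forall v, V v -> mdot (q - p) v = 0].

Definition qE (C : {set {set 'I_n}}) (q : conf) : conf := mproj (DeltaE C) q.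

Definition qI (C : {set {set 'I_n}}) (q : conf) : conf := mproj (DeltaI C) q.

Definition JE (C : {set {set 'I_n}}) (q : conf) : R := mnorm (qE C q) ^+ 2.

Definition SI (C : {set {set 'I_n}}) : set conf :=
  DeltaI C `&` [set q | mnorm q = 1].

(* For delta > 0 all terms are positive, so the neutral element 0 does not
   affect the maximum. *)
Definition Jgraf (delta : R) (q : conf) : R :=
  \big[Num.max/0]_(C : {set {set 'I_n}} | is_part C)
    (JE C q + delta ^+ #|C|).

Definition Xi (delta : R) (C : {set {set 'I_n}}) : set conf :=
  Mspace `&` [set q | JE C q + delta ^+ #|C| = Jgraf delta q].

(* Boundary in M: points of the ambient matrix space outside M are isolated
   in [subspace Mspace] and not in Xi, so they do not contribute. *)
Definition bXi (delta : R) (C : {set {set 'I_n}}) : set conf :=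
  @boundary (subspace Mspace) (Xi delta C).

Definition graf_nested (delta0 : R) : Prop :=
  forall delta : R, 0 < delta -> delta <= delta0 ->
  forall C D : {set {set 'I_n}}, is_part C -> is_part D ->
  Xi delta C `&` Xi delta D !=set0 -> finer C D \/ finer D C.

Definition blowup (C : {set {set 'I_n}}) : set (conf * R * conf) :=
  DeltaE C `*` [set r : R | 0 <= r] `*` SI C.

Definition to_blowup (C : {set {set 'I_n}}) (q : conf) : conf * R * conf :=
  (qE C q, mnorm (qI C q), (mnorm (qI C q))^-1 *: qI C q).

Local Notation blowup_ambient :=
  (prod_topology (fun _ : PDelta n => (conf * R * conf)%type)).

Definition blowup_prod : set blowup_ambient :=
  [set x | forall C : PDelta n, blowup (val C) (x C)].

Definition diag (q : conf) : blowup_ambient :=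
  fun C : PDelta n => to_blowup (val C) q.

(* The intersection is the closure relative to the subspace [blowup_prod]. *)
Definition MDelta : set blowup_ambient :=
  blowup_prod `&` closure (diag @` Mhat).

Definition bMDelta : set blowup_ambient := MDelta `\` (diag @` Mhat).

End Configurations.

Arguments mdot {R n d} m q q'.
Arguments mnorm {R n d} m q.
Arguments Mspace {R n} d m.
Arguments Msphere {R n} d m.
Arguments Delta {R n} d m.
Arguments Mhat {R n} d m.
Arguments DeltaE {R n} d m C.
Arguments DeltaI {R n} d m C.
Arguments SI {R n} d m C.
Arguments Xi {R n} d m delta C.
Arguments bXi {R n} d m delta C.
Arguments graf_nested {R n} d m delta0.
Arguments blowup {R n} d m C.
Arguments blowup_prod {R n} d m.
Arguments MDelta {R n} d m.
Arguments bMDelta {R n} d m.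

(* Main.v *)
(* The sphere without collisions, the boundary of the Graf cell and the boundary of
   a region {rho C >= eps C for all C} described below are radial graphs over the
   cone of collision-free configurations, hence homeomorphic by rescaling.

   Here rho C measures the distance to the collision subspace of C, and eps C grows
   so fast with C that at every point of the region the partitions with
   rho C < 2 eps C form a chain.  Contract the C-directions successively, from fine
   to coarse, so that rho C in [eps C, 2 eps C] is stretched onto [0, 2 eps C].  On
   the interior of the region this is a bijection onto the collision-free
   configurations, and its explicit inverse only uses the directions recorded by
   the blow-up coordinates.  Both maps therefore extend continuously to a
   homeomorphism of the region with M_Delta, which matches the boundaries. *)
Require Import Defs.
From mathcomp Require Import all_boot all_order all_algebra.
From mathcomp Require Import boolp classical_sets functions reals topology.
From mathcomp Require Import normedtype realfun.
From mathcomp Require Import ring lra.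

Set Implicit Arguments.
Unset Strict Implicit.
Unset Printing Implicit Defensive.

Import Order.TTheory GRing.Theory Num.Theory.
Import numFieldNormedType.Exports.

Local Open Scope ring_scope.

(** * Partitions as equivalence relations *)

Section Partitions.
Variable n : nat.
Implicit Types (C D E : {set {set 'I_n}}) (i j k : 'I_n).

(** Contraction loses information at the boundary of the region: if [rho C] equals [eps C] when the
    turn of C comes, the blocks of C collapse and the direction of the collapse disappears from the
    contracted point. The blow-up stores exactly this direction, so the expansion [tau] takes it as
    an argument instead of computing it.

    The main obstacle is interference: a contraction along D must not spoil the conditions on the
    partitions still to be treated. Those coarser than D keep their [rho] exactly, not just
    approximately, which is why [rho] has such an unusual definition. Those incomparable with D are
    far from collision whenever D is close to it, since otherwise their join with D would be too
    close.

    Limits of directions need no analysis. That the two maps are mutually inverse is checked where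
    every [rho C] exceeds [eps C], and on the diagonal image of the collision-free configurations.
    Both formulas are continuous up to the boundary, so the identities extend by density. *)

Definition same C : rel 'I_n := fun i j => finset.pblock C i == finset.pblock C j.

Lemma same_refl C : reflexive (same C).
Proof. by move=> i; exact: eqxx. Qed.

Lemma same_sym C : symmetric (same C).
Proof. by move=> i j; exact: eq_sym. Qed.

Lemma same_trans C : transitive (same C).
Proof. by move=> j i k; rewrite /same => /eqP->. Qed.

Lemma part_cover C i : is_part C -> i \in finset.cover C.
Proof. by move/cover_partition->; rewrite inE. Qed.

Lemma sameE C i j : is_part C -> same C i j = (j \in finset.pblock C i).
Proof.
move=> pC; apply: eq_pblock; last exact: part_cover.
by case/and3P: pC.
Qed.

Lemma sameP C i j : is_part C ->
  reflect (exists2 B, B \in C & i \in B /\ j \in B) (same C i j).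
Proof.
move=> pC; rewrite sameE //; apply: (iffP idP) => [ij|[B BC [iB jB]]].
  by exists (finset.pblock C i); rewrite ?pblock_mem ?mem_pblock ?part_cover.
by rewrite (def_pblock _ BC iB) //; case/and3P: pC.
Qed.

Lemma part_blocks C : is_part C -> C = [set [set j | same C i j] | i : 'I_n]%SET.
Proof.
move=> pC; have pb i : [set j | same C i j] = finset.pblock C i.
  by apply/setP => j; rewrite inE sameE.
apply/setP => B; apply/idP/imsetP => [BC|[i _ ->]].
  have [tC n0] : finset.trivIset C /\ finset.set0 \notin C by case/and3P: pC.
  have /finset.set0Pn[i iB] : B != finset.set0 by apply: contraNneq n0 => <-.
  by exists i => //; rewrite pb (def_pblock tC BC iB).
by rewrite pb pblock_mem ?part_cover.
Qed.

Lemma part_ext C D : is_part C -> is_part D -> same C =2 same D -> C = D.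
Proof.
move=> pC pD e; rewrite (part_blocks pC) (part_blocks pD).
by apply: eq_imset => i; apply/setP => j; rewrite !inE e.
Qed.

Definition rep C i : 'I_n := [arg min_(j < i | same C i j) (j : nat)]%N.

Lemma same_rep C i : same C i (rep C i).
Proof. by rewrite /rep; case: arg_minnP => //; exact: same_refl. Qed.

Lemma rep_min C i j : same C i j -> (rep C i <= j)%N.
Proof. by rewrite /rep; case: arg_minnP => [|k _ h /h//]; exact: same_refl. Qed.

Lemma rep_same C i j : same C i j -> rep C i = rep C j.
Proof.
move=> ij; apply/val_inj/anti_leq; rewrite !rep_min //.
  by apply: same_trans (same_rep C i); rewrite same_sym.
by apply: same_trans (same_rep C j).
Qed.

Lemma rep_leq C i : (rep C i <= i)%N.
Proof. by apply: rep_min; exact: same_refl. Qed.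

Definition lep C D := [forall i, forall j, same C i j ==> same D i j].

Lemma lepP C D : reflect (forall i j, same C i j -> same D i j) (lep C D).
Proof.
apply: (iffP forallP) => [h i j|h i]; first by move/forallP: (h i) => /(_ j)/implyP.
by apply/forallP => j; apply/implyP/h.
Qed.

Lemma lep_refl C : lep C C. Proof. exact/lepP. Qed.

Lemma lep_trans : transitive lep.
Proof. by move=> D C E /lepP h /lepP g; apply/lepP => i j /h/g. Qed.

Lemma rep_coarse C D i : lep C D -> rep D (rep C i) = rep D i.
Proof. by move=> /lepP h; apply/rep_same/h; rewrite same_sym same_rep. Qed.

Lemma rep_fine C D i : lep C D -> rep C (rep D i) = rep D i.
Proof.
move=> /lepP h; apply/val_inj/anti_leq; rewrite rep_leq rep_min //.
by apply: same_trans (same_rep D i) (h _ _ (same_rep C _)).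
Qed.

(** A rank that is strictly monotone under coarsening; it fixes both the scales [eps] and the order
    of the contractions. *)
Definition npairs C := #|[set p : 'I_n * 'I_n | same C p.1 p.2]%SET|.

Lemma npairs_lt C D : lep C D -> ~~ lep D C -> (npairs C < npairs D)%N.
Proof.
move=> /lepP h ndc; apply/proper_card/properP; split.
  by apply/fintype.subsetP => p; rewrite !inE; exact: h.
move: ndc; rewrite negb_forall => /existsP[i]; rewrite negb_forall => /existsP[j].
by rewrite negb_imply => /andP[Dij nCij]; exists (i, j); rewrite inE.
Qed.

Section FromRelation.
Variable e : rel 'I_n.
Hypothesis eqe : equivalence_rel e.

Definition part_of := equivalence_partition e [set: 'I_n]%SET.

Lemma part_of_part : is_part part_of.
Proof. by apply: equivalence_partitionP => x y z _ _ _; exact: eqe. Qed.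

Lemma same_part_of i j : same part_of i j = e i j.
Proof.
rewrite (sameE _ _ part_of_part) pblock_equivalence_partition ?inE //.

Qed.

End FromRelation.

Definition join := locked (fun C D => part_of (connect (relU (same C) (same D)))).

Lemma join_equiv C D : equivalence_rel (connect (relU (same C) (same D))).
Proof.
apply/equivalence_relP; split; first exact: connect0.
have sy : connect_sym (relU (same C) (same D)).
  by apply: sym_connect_sym => i j; rewrite /= !(same_sym _ i j).
move=> i j ij k; apply/idP/idP; last exact: connect_trans.
by apply: connect_trans; rewrite sy.
Qed.

Lemma join_part C D : is_part (join C D).
Proof. by rewrite /join -lock; apply: part_of_part; exact: join_equiv. Qed.

Lemma same_join C D i j :
  same (join C D) i j = connect (relU (same C) (same D)) i j.
Proof. by rewrite /join -lock; apply: same_part_of; exact: join_equiv. Qed.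

Lemma lep_joinl C D : lep C (join C D).
Proof. by apply/lepP => i j ij; rewrite same_join connect1 //= ij. Qed.

Lemma lep_joinr C D : lep D (join C D).
Proof. by apply/lepP => i j ij; rewrite same_join connect1 //= ij orbT. Qed.

Lemma eq_equiv : equivalence_rel (@eq_op 'I_n).
Proof. by move=> i j k; split=> // /eqP->. Qed.

Lemma Cmin_part : is_part (Cmin n) /\ forall i j, same (Cmin n) i j = (i == j).
Proof.
have -> : Cmin n = part_of (@eq_op 'I_n).
  rewrite (part_blocks (part_of_part eq_equiv)); apply: eq_imset => i.
  by apply/setP => j; rewrite !inE (same_part_of eq_equiv) eq_sym.
by split; [exact/part_of_part/eq_equiv | exact/same_part_of/eq_equiv].
Qed.

Lemma CminNP C : is_part C ->
  reflect (exists i j, i != j /\ same C i j) (C != Cmin n).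
Proof.
move=> pC; have [pm sm] := Cmin_part; apply: (iffP idP) => [|[i [j [nij ij]]]].
  apply: contra_neqP => /forallNP h; apply: part_ext => // i j; rewrite sm.
  apply/idP/eqP => [ij|->]; last exact: same_refl.
  by apply/eqP; have /forallNP/(_ j)/not_andP[/negP/negPn//|] := h i.
by apply: contraNneq nij => CE; rewrite -sm -CE.
Qed.

End Partitions.

(** * Size of the blocks of a partition *)

Section Spread.
Variables (R : realType) (n d : nat) (m : 'I_n -> R).
Local Notation conf := 'M[R]_(n, d).
Implicit Types (C D E : {set {set 'I_n}}) (z q : conf) (i j k : 'I_n) (l : 'I_d).

Definition wmap C z : conf := \matrix_(k, l) (z k l - z (rep C k) l).

Definition cen z : conf :=
  \matrix_(k, l) (z k l - (\sum_i m i * z i l) / \sum_i m i).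

Definition wt (k : 'I_n) : R := (n - k)%:R.

(* Deviations are taken from the block member of least index and weighted by wt,
   not from the centre of mass, so that rho C is insensitive to contractions of
   finer nearly collided partitions (rho_flat).  The definition is locked because
   comparing two values of rho by conversion unfolds the matrix norms. *)
Definition rho : {set {set 'I_n}} -> conf -> R :=
  locked (fun C z => `|(\matrix_(k, l) (wt k * wmap C z k l) : conf)|).

Lemma rhoE C z : rho C z = `|(\matrix_(k, l) (wt k * wmap C z k l) : conf)|.
Proof. by rewrite /rho -lock. Qed.

Lemma wmapD C z q : wmap C (z + q) = wmap C z + wmap C q.
Proof. by apply/matrixP => k l; rewrite !mxE; ring. Qed.

Lemma wmapZ C a z : wmap C (a *: z) = a *: wmap C z.
Proof. by apply/matrixP => k l; rewrite !mxE; ring. Qed.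

Lemma wmapB C z q : wmap C (z - q) = wmap C z - wmap C q.
Proof. by apply/matrixP => k l; rewrite !mxE; ring. Qed.

Lemma wmap_cen C z : wmap C (cen z) = wmap C z.
Proof. by apply/matrixP => k l; rewrite !mxE; ring. Qed.

Lemma wmap_coarse C D z : lep C D -> wmap C (wmap D z) = wmap C z.
Proof.
by move=> CD; apply/matrixP => k l; rewrite !mxE rep_coarse //; ring.
Qed.

Lemma wmap_rep C D z k l : lep C D -> rep C k = k ->
  wmap D (wmap C z) k l = 0.
Proof. by move=> CD kk; rewrite !mxE kk rep_fine // !subrr. Qed.

(** Recentring adds one common vector to all rows, which [wmap] does not see. A move along the
    D-deviations therefore just rescales the deviations of every C finer than D. *)
Lemma wmap_step C D z s : lep C D ->
  wmap C (z + s *: cen (wmap D z)) = (1 + s) *: wmap C z.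
Proof.
by move=> CD; rewrite wmapD wmapZ wmap_cen wmap_coarse // scalerDl scale1r.
Qed.

Lemma wmap_eq0P C z :
  reflect (forall i j, same C i j -> row i z = row j z) (wmap C z == 0).
Proof.
apply: (iffP eqP) => [/matrixP h i j ij|h].
  have e k l : z k l = z (rep C k) l.
    by apply/eqP; rewrite -subr_eq0; have := h k l; rewrite !mxE => ->.
  by apply/rowP => l; rewrite !mxE (e i) (rep_same ij) -e.
apply/matrixP => k l; rewrite !mxE; have /rowP/(_ l) := h _ _ (same_rep C k).
by rewrite !mxE => ->; rewrite subrr.
Qed.

Lemma wt_ge1 k : 1 <= wt k.
Proof. by rewrite /wt ler1n subn_gt0. Qed.

Lemma wt_gt0 k : 0 < wt k. Proof. exact: lt_le_trans (wt_ge1 k). Qed.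

Lemma wt_le k : wt k <= n%:R.
Proof. by rewrite /wt ler_nat leq_subr. Qed.

Lemma wt_lt j k : (j < k)%N -> wt k + 1 <= wt j.
Proof. by move=> jk; rewrite /wt natr1 ler_nat ltn_sub2l // (ltn_trans jk). Qed.

Lemma rho_ge0 C z : 0 <= rho C z. Proof. by rewrite rhoE. Qed.

Lemma rho_leP C z x : 0 <= x ->
  (forall k l, wt k * `|wmap C z k l| <= x) -> rho C z <= x.
Proof.
move=> x0 h; rewrite rhoE [leLHS]/Num.norm /= mx_normrE; apply/bigmax_leP.
by split=> // -[k l] _; rewrite /= mxE normrM gtr0_norm ?wt_gt0.
Qed.

Lemma rho_ge C z k l : wt k * `|wmap C z k l| <= rho C z.
Proof.
rewrite rhoE [leRHS]/Num.norm /= mx_normrE; apply/bigmax_geP; right.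
by exists (k, l) => //=; rewrite mxE normrM gtr0_norm ?wt_gt0.
Qed.

Lemma wmap_le C z k l : `|wmap C z k l| <= rho C z.
Proof.
by apply: le_trans (rho_ge C z k l); rewrite ler_peMl ?wt_ge1.
Qed.

Lemma rho_attained C z : 0 < rho C z ->
  exists k l, rho C z = wt k * `|wmap C z k l|.
Proof.
move=> r0; have : ~~ [forall p : 'I_n * 'I_d,
    wt p.1 * `|wmap C z p.1 p.2| < rho C z].
  apply/negP => /forallP h; suff: rho C z < rho C z by rewrite ltxx.
  rewrite {1}rhoE [ltLHS]/Num.norm /= mx_normrE; apply/bigmax_ltP.
  by split=> // p _; rewrite mxE normrM gtr0_norm ?wt_gt0.
rewrite negb_forall => /existsP[[k l]] /=; rewrite -leNgt => h.
by exists k, l; apply/le_anti; rewrite h rho_ge.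
Qed.

Lemma rho_scale C a z q : wmap C z = a *: wmap C q -> rho C z = `|a| * rho C q.
Proof.
move=> e; rewrite !rhoE e -normrZ; congr (`|_|).
by apply/matrixP => k l; rewrite !mxE; ring.
Qed.

Lemma rho_eq0 C z : (rho C z == 0) = (wmap C z == 0).
Proof.
apply/eqP/eqP => [r0|w0].
  apply/matrixP => k l; apply/eqP; rewrite [eqbRHS]mxE -normr_le0.
  by rewrite -[X in _ <= X]r0 wmap_le.
by rewrite (@rho_scale C 0 z z) ?normr0 ?mul0r // scale0r.
Qed.

Lemma rho_gt0 C z : (0 < rho C z) = (wmap C z != 0).
Proof. by rewrite lt_def rho_ge0 andbT rho_eq0. Qed.

(* The weights decrease along each block of D, so the maximum defining rho C is
   attained at representatives of D as soon as D-blocks are small. *)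
Lemma rho_flat_le D C z q (eta : R) : lep D C ->
  rho D z <= eta -> 2 * n%:R * eta < rho C z ->
  (forall k l, rep D k = k -> wmap C q k l = wmap C z k l) ->
  rho C z <= rho C q.
Proof.
move=> DC De Ce h.
have eta0 : 0 <= eta by apply: le_trans (rho_ge0 D z) De.
have [|k [l e]] := @rho_attained C z.
  by apply: le_lt_trans Ce; rewrite !mulr_ge0 ?ler0n.
have [kk|/eqP nk] := eqVneq (rep D k) k; first by rewrite e -h // rho_ge.
set j := rep D k in nk *.
have jk : (j < k)%N.
  by rewrite ltn_neqAle rep_leq andbT; apply/eqP => /val_inj.
have jj : rep D j = j by rewrite /j rep_coarse ?lep_refl.
have cj : rep C j = rep C k by rewrite rep_coarse.
apply: le_trans (rho_ge C q j l); rewrite h //.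
set X := `|wmap C z j l|.
have X0 : 0 <= X by exact: normr_ge0.
have wX : wt k * `|wmap C z k l| <= eta + wt k * X.
  have -> : wmap C z k l = wmap D z k l + wmap C z j l.
    by rewrite !mxE cj -/j; ring.
  apply: (@le_trans _ _ (wt k * (`|wmap D z k l| + X))).
    by rewrite ler_wpM2l ?ler_normD // ltW ?wt_gt0.
  by rewrite mulrDr lerD2r (le_trans (rho_ge D z k l)).
have kn := wt_le k; have k1 := wt_ge1 k; have kj := wt_lt jk.
(* The weight drops by at least 1 from j to k, which absorbs the error [eta] once [eta <= X]. If
   [X < eta], the maximum would be at most [2 * n%:R * eta]. *)
suff Xe : eta <= X.
  rewrite e; apply: le_trans wX _; apply: (@le_trans _ _ ((wt k + 1) * X)).
    by rewrite mulrDl mul1r addrC lerD2l.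
  by rewrite ler_wpM2r.
rewrite leNgt; apply/negP => Xe; move: Ce; apply/negP; rewrite -leNgt e.
apply: le_trans wX _; rewrite [2 * _]mulr_natl mulr2n mulrDl lerD //.
  by rewrite ler_peMl // (le_trans k1).
by rewrite ler_pM // ltW // wt_gt0.
Qed.

(** Up to a common translation the move vanishes at the representatives of D, and these alone
    determine [rho C] when D-blocks are small. Smallness is needed before and after the move, to
    apply [rho_flat_le] in both directions. *)
Lemma rho_flat D C z s (eta : R) : lep D C ->
  let q := z + s *: cen (wmap D z) in
  rho D z <= eta -> rho D q <= eta -> 2 * n%:R * eta < rho C z ->
  rho C q = rho C z.
Proof.
move=> DC q Dz Dq Cz.
have h k l : rep D k = k -> wmap C q k l = wmap C z k l.
  move=> kk; rewrite /q wmapD wmapZ wmap_cen mxE [X in _ + X]mxE wmap_rep //.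
  by rewrite mulr0 addr0.
have zq : rho C z <= rho C q by apply: (rho_flat_le DC Dz).
apply/le_anti/andP; split=> //; apply: (rho_flat_le DC Dq) => [|k l /h//].
exact: lt_le_trans zq.
Qed.

(** Two indices in one block of the join are linked by a path of at most n steps, each inside a
    block of C or of D and of length at most [2 * eta]; the remaining factor n bounds the weight. *)
Lemma rho_join C D z (eta : R) : 0 <= eta ->
  rho C z <= eta -> rho D z <= eta ->
  rho (join C D) z <= 2 * n%:R ^+ 2 * eta.
Proof.
move=> eta0 Cz Dz; have n0 : 0 <= n%:R :> R by exact: ler0n.
have step E i j l : rho E z <= eta -> same E i j -> `|z i l - z j l| <= 2 * eta.
  move=> Ez ij; have -> : z i l - z j l = wmap E z i l - wmap E z j l.
    by rewrite !mxE (rep_same ij); ring.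
  apply: le_trans (ler_normB _ _) _.
  by rewrite mulr_natl mulr2n lerD // (le_trans (wmap_le _ _ _ _)).
apply: rho_leP => [|k l]; first by rewrite !mulr_ge0 ?exprn_ge0.
suff : `|wmap (join C D) z k l| <= n%:R * (2 * eta).
  have := wt_le k; have := wt_gt0 k; have := normr_ge0 (wmap (join C D) z k l).
  set a := wt k; set b := `|_|; set x := n%:R => b0 a0 ax bx.
  apply: (@le_trans _ _ (x * (x * (2 * eta)))); last first.
    by rewrite le_eqVlt; apply/orP; left; apply/eqP; ring.
  by apply: ler_pM => //; apply: ltW.
rewrite mxE; have := same_rep (join C D) k; rewrite same_join => /connectP[p0 p0P ->].
case/shortenP: p0P => p pP up _.
have : (size p <= n)%N.
  by have := max_card [in k :: p]; rewrite (card_uniqP up) card_ord => /ltnW.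
rewrite -(ler_nat R) => sp; apply: (@le_trans _ _ ((size p)%:R * (2 * eta))); last first.
  by rewrite ler_wpM2r // mulr_ge0.
elim: p k pP {up sp} => [|j p IH] k /=; first by rewrite subrr normr0 mul0r.
case/andP => kj /IH {}IH; rewrite -[z k l](subrK (z j l)) -addrA.
apply: le_trans (ler_normD _ _) _; rewrite -natr1 mulrDl mul1r [leRHS]addrC lerD //.
case/orP: kj => kj; first exact: step Cz kj.
exact: step Dz kj.
Qed.

(** The factor [4 * n%:R ^+ 2] is the constant of [rho_join] applied at the threshold [2 * eps],
    where contractions become active. *)
Lemma exists_scales : exists eps : {set {set 'I_n}} -> R,
  (forall C, 0 < eps C) /\
  forall C D, lep C D -> ~~ lep D C -> 4 * n%:R ^+ 2 * eps C < eps D.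
Proof.
pose ratio : R := (4 * n ^ 2).+1%:R.
have r0 : 0 < ratio by rewrite ltr0n.
exists (fun C => ratio ^+ npairs C); split=> [C|C D CD nDC].
  by rewrite exprn_gt0.
have r1 : 1 <= ratio by rewrite ler1n.
apply: (@lt_le_trans _ _ (ratio ^+ (npairs C).+1)); last first.
  by apply: ler_weXn2l => //; exact: npairs_lt.
rewrite [ltRHS]exprS ltr_pM2r ?exprn_gt0 // /ratio -[ltRHS]natr1 natrM natrX.
by rewrite ltrDl.
Qed.

End Spread.

(** * Successive contractions and expansions *)

Section Contraction.
Variables (R : realType) (n d : nat) (m : 'I_n -> R).
Hypothesis n0 : (0 < n)%N.
Variable eps : {set {set 'I_n}} -> R.
Hypothesis eps_gt0 : forall C, 0 < eps C.
Hypothesis eps_lt : forall C D, lep C D -> ~~ lep D C ->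
  4 * n%:R ^+ 2 * eps C < eps D.
Local Notation conf := 'M[R]_(n, d).
Implicit Types (C D E : {set {set 'I_n}}) (y z q : conf).
Implicit Types (l : seq {set {set 'I_n}}).

Lemma near_join C D z : ~~ lep C D -> ~~ lep D C ->
  rho C z <= 2 * eps C -> rho D z <= 2 * eps D ->
  rho (join C D) z < eps (join C D).
Proof.
move=> nCD nDC Cz Dz; set E := join C D.
have CE : 4 * n%:R ^+ 2 * eps C < eps E.
  apply: eps_lt; first exact: lep_joinl.
  by apply: contra nDC; apply: lep_trans; exact: lep_joinr.
have DE : 4 * n%:R ^+ 2 * eps D < eps E.
  apply: eps_lt; first exact: lep_joinr.
  by apply: contra nCD; apply: lep_trans; exact: lep_joinl.
set a := Num.max (eps C) (eps D).
have aE : 4 * n%:R ^+ 2 * a < eps E by rewrite /a maxElt; case: ifP.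
have Ca : eps C <= a by rewrite le_max lexx.
have Da : eps D <= a by rewrite le_max lexx orbT.
have a0 : 0 <= 2 * a by rewrite mulr_ge0 // (le_trans _ Ca) // ltW // eps_gt0.
apply: le_lt_trans (rho_join a0 _ _) _.
- by apply: le_trans Cz _; rewrite ler_pM2l.
- by apply: le_trans Dz _; rewrite ler_pM2l.
by apply: le_lt_trans aE; rewrite le_eqVlt; apply/orP; left; apply/eqP; ring.
Qed.

(** The coefficient s is arbitrary so that contractions and expansions are covered at once. If C is
    coarser than D, [rho_flat] gives equality. If the two are incomparable, [near_join] keeps C far
    from collision at both ends of the move, because [rho] of the join does not change. *)
Lemma rho_step C D z s :
  let q := z + s *: cen m (wmap D z) in
  ~~ lep C D -> rho D z <= 2 * eps D -> rho D q <= 2 * eps D ->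
  eps C <= rho C z -> eps (join C D) <= rho (join C D) z ->
  rho C q = rho C z \/ (2 * eps C <= rho C z /\ 2 * eps C <= rho C q).
Proof.
move=> q nCD Dz Dq Cz CDz.
have flat E : lep D E -> ~~ lep E D -> eps E <= rho E z -> rho E q = rho E z.
  move=> DE nED Ez; apply: (rho_flat DE Dz Dq); apply: lt_le_trans Ez.
  apply: le_lt_trans (eps_lt DE nED).
  rewrite (_ : _ * (_ * _) = 4 * n%:R * eps D); last by ring.
  rewrite ler_pM2r ?eps_gt0 // ler_pM2l // expr2 ler_peMr //.
  by rewrite ler1n.
have [DC|nDC] := boolP (lep D C); first by left; apply: flat.
right; split; rewrite leNgt; apply/negP => /ltW h.
  by have := near_join nCD nDC h Dz; rewrite ltNge CDz.
have := near_join nCD nDC h Dq; rewrite flat ?ltNge ?CDz //.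
  exact: lep_joinr.
by apply: contra nCD; apply: lep_trans; exact: lep_joinl.
Qed.

(** * A single contraction and its inverse expansion *)

Definition ndir C z : conf := (rho C z)^-1 *: cen m (wmap C z).

(** Chosen so that [sigma C] turns a value r of [rho C] in [eps C, 2 eps C] into 2 r - 2 eps C and
    is the identity beyond. *)
Definition beta C z : R := Num.max 0 (2 * eps C - rho C z) / rho C z.

Definition sigma C z : conf := z - beta C z *: cen m (wmap C z).

(** The added length inverts r -> 2 r - 2 eps C. As u is a parameter, the formula stays meaningful
    and continuous where [rho C z] is 0. *)
Definition tau C (u : conf) z : conf := z + Num.max 0 (eps C - rho C z / 2) *: u.

Lemma cenZ a z : cen m (a *: z) = a *: cen m z.
Proof.
apply/matrixP => k l; rewrite !mxE mulrBr mulrA mulr_sumr; congr (_ - _ / _).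
by apply: eq_bigr => i _; rewrite mxE; ring.
Qed.

Lemma ndir_scale C a q z : 0 < a -> wmap C q = a *: wmap C z ->
  ndir C q = ndir C z.
Proof.
move=> a0 e; rewrite /ndir e cenZ (rho_scale e) gtr0_norm // scalerA invfM.
by rewrite mulrAC mulVf ?gt_eqF // mul1r.
Qed.

Lemma sigmaE C z : sigma C z = z + (- beta C z) *: cen m (wmap C z).
Proof. by rewrite scaleNr. Qed.

Lemma sigma_far C z : 2 * eps C <= rho C z -> sigma C z = z.
Proof.
move=> h; rewrite /sigma /beta max_l; first by rewrite mul0r scale0r subr0.
by rewrite subr_le0.
Qed.

Lemma sigma_wmap C D z : lep C D ->
  wmap C (sigma D z) = (1 - beta D z) *: wmap C z.
Proof. by move=> CD; rewrite sigmaE wmap_step. Qed.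

Lemma beta_le1 C z : eps C <= rho C z -> beta C z <= 1.
Proof.
move=> h; have e0 := eps_gt0 C; rewrite ler_pdivrMr ?(lt_le_trans e0) // mul1r.
by rewrite ge_max rho_ge0 /=; lra.
Qed.

Lemma beta_lt1 C z : eps C < rho C z -> beta C z < 1.
Proof.
move=> h; have e0 := eps_gt0 C; rewrite ltr_pdivrMr ?(lt_trans e0) // mul1r.
by rewrite gt_max (lt_trans e0 h) /=; lra.
Qed.

Lemma rho_sigma C z : eps C <= rho C z ->
  rho C (sigma C z) = rho C z - Num.max 0 (2 * eps C - rho C z).
Proof.
move=> h; rewrite (rho_scale (sigma_wmap z (lep_refl C))) ger0_norm; last first.
  by rewrite subr_ge0 beta_le1.
rewrite mulrBl mul1r /beta divfK // gt_eqF // (lt_le_trans _ h) //.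
Qed.

Lemma sigma_step C D z : ~~ lep C D -> eps D <= rho D z ->
  eps C <= rho C z -> eps (join C D) <= rho (join C D) z ->
  rho C (sigma D z) = rho C z \/
  (2 * eps C <= rho C z /\ 2 * eps C <= rho C (sigma D z)).
Proof.
move=> nCD Dz Cz CDz; have [h|/ltW h] := leP (2 * eps D) (rho D z).
  by left; rewrite sigma_far.
rewrite sigmaE; apply: rho_step => //; rewrite -sigmaE rho_sigma //.
by apply: le_trans h; rewrite lerBlDr lerDl le_max lexx.
Qed.

Lemma tau_far C u z : 2 * eps C <= rho C z -> tau C u z = z.
Proof.
move=> h; rewrite /tau max_l ?scale0r ?addr0 //; lra.
Qed.

Lemma tau_sigma C z : eps C <= rho C z -> tau C (ndir C z) (sigma C z) = z.
Proof.
move=> h; rewrite /tau rho_sigma // /sigma /beta /ndir scalerA.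
rewrite -addrA -scaleNr -scalerDl -mulNr -mulrDl.
set a := Num.max 0 (2 * eps C - rho C z).
suff -> : Num.max 0 (eps C - (rho C z - a) / 2) = a.
  by rewrite addNr mul0r scale0r addr0.
have [h2|h2] := leP (2 * eps C) (rho C z).
  have a0 : a = 0 by rewrite /a max_l // subr_le0.
  by rewrite a0 max_l //; lra.
have a0 : a = 2 * eps C - rho C z by rewrite /a max_r // subr_ge0 ltW.
by rewrite a0 max_r; lra.
Qed.

Lemma tauE C z :
  tau C (ndir C z) z =
  z + (Num.max 0 (eps C - rho C z / 2) / rho C z) *: cen m (wmap C z).
Proof. by rewrite /tau /ndir scalerA. Qed.

Lemma rho_tau C z : 0 < rho C z ->
  rho C (tau C (ndir C z) z) = rho C z + Num.max 0 (eps C - rho C z / 2).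
Proof.
move=> z0; rewrite tauE; set a := Num.max _ _.
have a0 : 0 <= a by rewrite le_max lexx.
rewrite (rho_scale (wmap_step _ _ _ (lep_refl C))) ger0_norm.
  by rewrite mulrDl mul1r divfK // gt_eqF.
by rewrite addr_ge0 // divr_ge0 // ltW.
Qed.

Lemma rho_tau_gt C z : 0 < rho C z -> eps C < rho C (tau C (ndir C z) z).
Proof.
move=> z0; rewrite rho_tau // -ltrBlDl lt_max; apply/orP; right.
by lra.
Qed.

Lemma sigma_tau C z : 0 < rho C z -> sigma C (tau C (ndir C z) z) = z.
Proof.
move=> z0; have [h|h] := leP (2 * eps C) (rho C z).
  by rewrite !tau_far // sigma_far.
set w := eps C - rho C z / 2.
have w0 : 0 < w by rewrite /w; lra.
have wE : Num.max 0 w = w by rewrite max_r // ltW.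
have wE2 : Num.max 0 (2 * eps C - (rho C z + w)) = w by rewrite /w max_r; lra.
rewrite /sigma /beta rho_tau // -/w wE wE2 tauE -/w wE wmap_step ?lep_refl //.
rewrite cenZ scalerA -addrA -scalerBl; set b := (X in X *: _).
suff -> : b = 0 by rewrite scale0r addr0.
by rewrite /b; field; rewrite !gt_eqF // addr_gt0.
Qed.

Lemma tau_step C D z : 0 < rho D z -> ~~ lep C D ->
  eps C <= rho C z -> eps (join C D) <= rho (join C D) z ->
  rho C (tau D (ndir D z) z) = rho C z \/
  (2 * eps C <= rho C z /\ 2 * eps C <= rho C (tau D (ndir D z) z)).
Proof.
move=> z0 nCD Cz CDz; have [h|h] := leP (2 * eps D) (rho D z).
  by left; rewrite tau_far.
rewrite tauE; apply: rho_step => //; first exact: ltW.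
rewrite -tauE rho_tau //; move: (rho D z) h => r h.
by rewrite max_r; lra.
Qed.

(** * Compositions along a list of partitions *)

Definition Sfold l z : conf := foldl (fun z C => sigma C z) z l.

Definition Tfold (u : {set {set 'I_n}} -> conf) l z : conf :=
  foldr (fun C z => tau C (u C) z) z l.

(** No later member refines an earlier one, and coarsenings stay in the list. Both properties pass
    to tails, so the join of D with a later member is itself still to come when D is treated. *)
Definition upper l : Prop :=
  pairwise (fun D C => ~~ lep C D) l /\
  forall C E, C \in l -> is_part E -> lep C E -> E \in l.

Definition good l z := forall C, C \in l -> eps C <= rho C z.

Definition sgood l z := forall C, C \in l -> eps C < rho C z.

Lemma sgood_good l z : sgood l z -> good l z.
Proof. by move=> h C /h/ltW. Qed.

Lemma upper_cons D l : upper (D :: l) ->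
  [/\ upper l, forall C, C \in l -> ~~ lep C D &
      forall C, C \in l -> join C D \in l].
Proof.
case=> /= /andP[/allP Dl pl] cl; have u : upper l.
  split=> // C E Cl pE CE; have := cl C E; rewrite !inE Cl orbT => /(_ isT pE CE).
  by case/orP => // /eqP ED; move: (Dl _ Cl); rewrite -ED CE.
split=> // C Cl; apply: u.2 Cl _ _; first exact: join_part.
exact: lep_joinl.
Qed.

Lemma good_sigma D l z : upper (D :: l) -> good (D :: l) z -> good l (sigma D z).
Proof.
move=> /upper_cons[u nl jl] g C Cl.
have gz E : E \in D :: l -> eps E <= rho E z by exact: g.
have [|||||[_]] := @sigma_step C D z.
- exact: nl.
- by rewrite gz ?mem_head.
- by rewrite gz // inE Cl orbT.
- by rewrite gz // inE jl ?orbT.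
- by move->; rewrite gz // inE Cl orbT.
- by apply: le_trans; have := eps_gt0 C; lra.
Qed.

Lemma sgood_sigma D l z : upper (D :: l) -> sgood (D :: l) z -> sgood l (sigma D z).
Proof.
move=> /upper_cons[u nl jl] g C Cl.
have gz E : E \in D :: l -> eps E <= rho E z by move/g/ltW.
have [|||||[_]] := @sigma_step C D z.
- exact: nl.
- by rewrite gz ?mem_head.
- by rewrite gz // inE Cl orbT.
- by rewrite gz // inE jl ?orbT.
- by move->; rewrite g // inE Cl orbT.
- by apply: lt_le_trans; have := eps_gt0 C; lra.
Qed.

Lemma Sfold_far l z : (forall C, C \in l -> 2 * eps C <= rho C z) -> Sfold l z = z.
Proof.
elim: l => //= D l IH h; rewrite sigma_far ?h ?mem_head //.
by apply: IH => C Cl; rewrite h // inE Cl orbT.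
Qed.

Definition below C l := [seq E <- l | ~~ lep C E].

(* Nearly collided partitions are pairwise comparable, so no later contraction
   except those along coarsenings of D is active once D is nearly collided. *)
Lemma Sfold_near C D l z : upper (D :: l) -> good l z ->
  rho D z <= 2 * eps D -> lep C D -> Sfold (below C l) z = z.
Proof.
move=> /upper_cons[u nl jl] g Dz CD; apply: Sfold_far => E.
rewrite mem_filter => /andP[nCE El]; rewrite leNgt; apply/negP => /ltW Ez.
have nDE : ~~ lep D E by apply: contra nCE; exact: lep_trans.
by have := near_join (nl _ El) nDE Ez Dz; rewrite ltNge g ?jl.
Qed.

(** An omitted contraction along a coarsening D of C is either inactive or makes all the remaining
    ones of [below C l] inactive, by [Sfold_near]; in the latter case it only multiplies the
    C-deviations by [1 - beta D y], which is positive by strictness. *)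
Lemma Sfold_dir l y C : upper l -> sgood l y ->
  exists2 a, 0 < a & wmap C (Sfold l y) = a *: wmap C (Sfold (below C l) y).
Proof.
elim: l y => [|D l IH] y ul gy /=; first by exists 1; rewrite ?scale1r.
have [u nl jl] := upper_cons ul; have g' := sgood_sigma ul gy.
have [a a0 e] := IH _ u g'; rewrite /below /=.
have [CD|nCD] := boolP (lep C D); last by exists a.
have gl : good l y by move=> E El; rewrite ltW // gy // inE El orbT.
rewrite e -/(below C l); have [h|/ltW h] := leP (2 * eps D) (rho D y).
  by exists a => //; rewrite sigma_far.
have Dy : eps D < rho D y by rewrite gy // mem_head.
exists (a * (1 - beta D y)); first by rewrite mulr_gt0 // subr_gt0 beta_lt1.
have h' : rho D (sigma D y) <= 2 * eps D.
  rewrite rho_sigma; last exact: ltW.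
  by apply: le_trans h; rewrite lerBlDr lerDl le_max lexx.
rewrite (Sfold_near ul gl h CD) (Sfold_near ul (sgood_good g') h' CD).
by rewrite sigma_wmap // scalerA.
Qed.

(** This is what makes the C-direction defined on the whole closed region. The coarsenings of C are
    closed under joins with any D, so [sigma_step] applies to each of them whenever D does not
    coarsen C. *)
Lemma below_good C l y : upper l -> good l y ->
  (forall E, is_part E -> lep C E -> eps E <= rho E y) ->
  forall E, is_part E -> lep C E -> eps E <= rho E (Sfold (below C l) y).
Proof.
elim: l y => //= D l IH y ul gy H; have [u nl jl] := upper_cons ul.
have gl : good l y by move=> E El; rewrite gy // inE El orbT.
rewrite /below /=; case: ifP => [nCD|_]; last exact: IH.
apply: IH => //; first exact: good_sigma.
move=> E pE CE; have [|||||[_]] := @sigma_step E D y.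
- by apply: contra nCD; exact: lep_trans.
- by rewrite gy // mem_head.
- exact: H.
- apply: H; first exact: join_part.
  exact: lep_trans (lep_joinl E D).
- by move->; exact: H.
- by apply: le_trans; have := eps_gt0 E; lra.
Qed.

(** A direction [u D] matters only while D is nearly collided. Then the contractions in [below D l]
    are inactive, and [u D] is the direction at the very point that D contracted. *)
Lemma Tfold_Sfold l u y : upper l -> good l y ->
  (forall C, C \in l -> u C = ndir C (Sfold (below C l) y)) ->
  Tfold u l (Sfold l y) = y.
Proof.
elim: l y => //= D l IH y ul gy uE; have [u' nl jl] := upper_cons ul.
rewrite IH //; last first.
- move=> C Cl; rewrite uE; last by rewrite inE Cl orbT.
  by rewrite /below /= nl.
- exact: good_sigma.
have Dy : eps D <= rho D y by rewrite gy // mem_head.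
have [h|/ltW h] := leP (2 * eps D) (rho D y).
  by rewrite sigma_far // tau_far.
have gl : good l y by move=> E El; rewrite gy // inE El orbT.
by rewrite uE ?mem_head // /below /= lep_refl /= (Sfold_near ul) ?lep_refl ?tau_sigma.
Qed.

(** All directions may be read from the final point q: by [Sfold_dir] and [Sfold_near], when the
    expansion along D is active its current point has the same D-direction as q. *)
Lemma Sfold_Tfold l q : upper l -> (forall C, C \in l -> wmap C q != 0) ->
  let y := Tfold (ndir^~ q) l q in sgood l y /\ Sfold l y = q.
Proof.
elim: l => //= D l IH ul q0; have [u nl jl] := upper_cons ul.
have [C Cl|g e] := IH u; first by rewrite q0 // inE Cl orbT.
set z := Tfold _ l q in g e *.
have Dq : wmap D q != 0 by rewrite q0 ?mem_head.
have [h|h] := leP (2 * eps D) (rho D z).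
  rewrite tau_far // sigma_far //; split=> // C; rewrite inE => /predU1P[->|/g//].
  by apply: lt_le_trans h; have := eps_gt0 D; lra.
have [a a0] := Sfold_dir D u g.
rewrite e (Sfold_near ul (sgood_good g)) ?lep_refl // ?ltW // => ea.
have z0 : 0 < rho D z.
  by rewrite rho_gt0; apply: contraNneq Dq => zE; rewrite ea zE scaler0.
rewrite (ndir_scale a0 ea); split; last by rewrite sigma_tau.
move=> C; rewrite inE => /predU1P[->|Cl]; first exact: rho_tau_gt.
have [||||[_]] := @tau_step C D z z0.
- exact: nl.
- by rewrite ltW // g.
- by rewrite ltW // g // jl.
- by move->; rewrite g.
- by apply: lt_le_trans; have := eps_gt0 C; lra.
Qed.

End Contraction.

(** * Orthogonal projections *)

Section Projections.
Variables (R : realType) (n d : nat) (m : 'I_n -> R).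
Hypothesis m_gt0 : forall i, 0 < m i.
Local Notation conf := 'M[R]_(n, d).
Local Notation mdot := (mdot m).
Local Notation mnorm := (mnorm m).
Implicit Types (C D E : {set {set 'I_n}}) (p q v z : conf).

Lemma MspaceP q : Mspace d m q <-> forall l, \sum_i m i * q i l = 0.
Proof.
have e l : (\sum_(i < n) m i *: row i q) 0 l = \sum_i m i * q i l.
  by rewrite summxE; apply: eq_bigr => i _; rewrite !mxE.
split=> [h l|h]; first by rewrite -e h mxE.
by apply/rowP => l; rewrite e h mxE.
Qed.

Lemma Mspace_lin a p q : Mspace d m p -> Mspace d m q -> Mspace d m (p + a *: q).
Proof.
move=> /MspaceP hp /MspaceP hq; apply/MspaceP => l.
under eq_bigr do rewrite !mxE mulrDr mulrCA.
by rewrite big_split /= -mulr_sumr hp hq mulr0 addr0.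
Qed.

Lemma MspaceZ a q : Mspace d m q -> Mspace d m (a *: q).
Proof.
move=> /MspaceP hq; apply/MspaceP => l.
by under eq_bigr do rewrite mxE mulrCA; rewrite -mulr_sumr hq mulr0.
Qed.

Lemma MspaceB p q : Mspace d m p -> Mspace d m q -> Mspace d m (p - q).
Proof. by move=> hp hq; rewrite -scaleN1r; exact: Mspace_lin. Qed.

Lemma sum_m_gt0 (P : pred 'I_n) k : P k -> 0 < \sum_(i | P i) m i.
Proof.
move=> Pk; rewrite (bigD1 k) //= ltr_pwDl // sumr_ge0 // => i _; exact: ltW.
Qed.

Lemma Mspace_cen z : (0 < n)%N -> Mspace d m (cen m z).
Proof.
move=> n0; apply/MspaceP => l.
under eq_bigr do rewrite mxE mulrBr.
rewrite sumrB -mulr_suml mulrC divfK ?subrr // gt_eqF //.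
exact: (@sum_m_gt0 predT (Ordinal n0)).
Qed.

Lemma mdotC p q : mdot p q = mdot q p.
Proof.
by apply: eq_bigr => i _; congr (_ * _); apply: eq_bigr => k _; rewrite mulrC.
Qed.

Lemma mdotDl p q v : mdot (p + q) v = mdot p v + mdot q v.
Proof.
rewrite /Defs.mdot -big_split /=; apply: eq_bigr => i _; rewrite -mulrDr -big_split /=.
by congr (_ * _); apply: eq_bigr => k _; rewrite mxE mulrDl.
Qed.

Lemma mdotZl a p v : mdot (a *: p) v = a * mdot p v.
Proof.
rewrite /Defs.mdot mulr_sumr; apply: eq_bigr => i _; rewrite mulrCA; congr (_ * _).
by rewrite mulr_sumr; apply: eq_bigr => k _; rewrite mxE mulrA.
Qed.

Lemma mdotBl p q v : mdot (p - q) v = mdot p v - mdot q v.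
Proof. by rewrite mdotDl -scaleN1r mdotZl mulN1r. Qed.

Lemma mdotDr v p q : mdot v (p + q) = mdot v p + mdot v q.
Proof. by rewrite mdotC mdotDl !(mdotC v). Qed.

Lemma mdotE p q : mdot p q = \sum_l \sum_i m i * p i l * q i l.
Proof.
rewrite exchange_big /=; apply: eq_bigr => i _; rewrite mulr_sumr.
by apply: eq_bigr => k _; rewrite mulrA.
Qed.

Lemma mdot_ge0 p : 0 <= mdot p p.
Proof.
apply: sumr_ge0 => i _; apply: mulr_ge0; first exact: ltW.
by apply: sumr_ge0 => k _; rewrite -expr2 sqr_ge0.
Qed.

Lemma mdot_eq0 p : mdot p p = 0 -> p = 0.
Proof.
move=> /eqP; rewrite psumr_eq0 => [/allP h|i _]; last first.
  apply: mulr_ge0; first exact: ltW.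
  by apply: sumr_ge0 => k _; rewrite -expr2 sqr_ge0.
apply/matrixP => i k; have := h i (mem_index_enum i).
rewrite mulf_eq0 gt_eqF //= psumr_eq0 => [/allP h'|? _]; last by rewrite -expr2 sqr_ge0.
by have := h' k (mem_index_enum k); rewrite -expr2 sqrf_eq0 mxE => /eqP.
Qed.

Lemma mnorm_ge0 p : 0 <= mnorm p. Proof. exact: sqrtr_ge0. Qed.

Lemma mnorm_sqr p : mnorm p ^+ 2 = mdot p p.
Proof. by rewrite sqr_sqrtr // mdot_ge0. Qed.

Lemma mnormZ a p : mnorm (a *: p) = `|a| * mnorm p.
Proof.
rewrite /Defs.mnorm mdotZl mdotC mdotZl mulrA -expr2 sqrtrM ?sqr_ge0 //.
by rewrite sqrtr_sqr.
Qed.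

Lemma mnorm_eq0 p : (mnorm p == 0) = (p == 0).
Proof.
apply/eqP/eqP => [h|->]; first by apply: mdot_eq0; rewrite -mnorm_sqr h expr0n.
by rewrite -(scale0r 0) mnormZ normr0 mul0r.
Qed.

Lemma mnorm_gt0 p : (0 < mnorm p) = (p != 0).
Proof. by rewrite lt_def mnorm_ge0 andbT mnorm_eq0. Qed.

Definition projE C q : conf :=
  \matrix_(k, l) ((\sum_(i | same C k i) m i * q i l) / \sum_(i | same C k i) m i).

Definition projI C q : conf := q - projE C q.

Lemma projE_lin C a p q : projE C (p + a *: q) = projE C p + a *: projE C q.
Proof.
apply/matrixP => k l; rewrite !mxE mulrA -mulrDl mulr_sumr -big_split /=.
by congr (_ / _); apply: eq_bigr => i _; rewrite !mxE; ring.
Qed.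

Lemma eq_same C i j : same C i j -> same C i =1 same C j.
Proof.
move=> ij k; apply/idP/idP; last exact: same_trans.
by apply: same_trans; rewrite same_sym.
Qed.

Lemma wmap_projE C q : wmap C (projE C q) = 0.
Proof.
apply/eqP/wmap_eq0P => i j ij; apply/rowP => l; rewrite !mxE.
by congr (_ / _); apply: eq_bigl; exact: eq_same.
Qed.

Lemma wmap_projI C q : wmap C (projI C q) = wmap C q.
Proof. by rewrite wmapB wmap_projE subr0. Qed.

Lemma projE_id C q : wmap C q = 0 -> projE C q = q.
Proof.
move=> /eqP/wmap_eq0P h; apply/matrixP => k l; rewrite mxE.
have e i : same C k i -> m i * q i l = m i * q k l.
  by move=> /h /rowP/(_ l); rewrite !mxE => ->.
rewrite (eq_bigr _ e) -mulr_suml mulrAC divff ?mul1r // gt_eqF //.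
by apply: (sum_m_gt0 (k := k)); exact: same_refl.
Qed.

Lemma projI_eq0 C q : (projI C q == 0) = (wmap C q == 0).
Proof.
apply/eqP/eqP => [h|/projE_id h]; last by rewrite /projI h subrr.
rewrite -wmap_projI h; apply/eqP/wmap_eq0P => i j _.
by apply/rowP => l; rewrite !mxE.
Qed.

Lemma projI_scale C a q z : wmap C q = a *: wmap C z -> projI C q = a *: projI C z.
Proof.
move=> e; have : projI C (q - a *: z) = 0.
  by apply/eqP; rewrite projI_eq0 wmapB wmapZ e subrr.
rewrite /projI -scaleNr projE_lin !scaleNr scalerBr => h.
apply/eqP; rewrite -subr_eq0 -h; apply/eqP.
by apply/matrixP => k l; rewrite !mxE; ring.
Qed.

(** Averaging over blocks preserves weighted sums against block-constant functions. With f a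
    block-constant configuration this is orthogonality; with f = 1 it preserves the centre of
    mass. *)
Lemma projE_adj C q (f : 'I_n -> R) l : (forall i j, same C i j -> f i = f j) ->
  \sum_k m k * projE C q k l * f k = \sum_k m k * q k l * f k.
Proof.
move=> hf; under eq_bigr do rewrite mxE !mulr_suml mulr_sumr mulr_suml.
rewrite (exchange_big_dep predT) //=; apply: eq_bigr => i _.
have W0 : \sum_(j | same C i j) m j != 0.
  by rewrite gt_eqF // (sum_m_gt0 (k := i)) //; exact: same_refl.
transitivity (\sum_(k | same C i k) m k * (m i * q i l * f i / \sum_(j | same C i j) m j)).
  apply: eq_big => [k|k ki]; first exact: same_sym.
  rewrite (hf _ _ ki) (eq_bigl _ _ (eq_same ki)); ring.
by rewrite -mulr_suml mulrC divfK.
Qed.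

Lemma mdot_projE C q v : wmap C v = 0 -> mdot (projE C q) v = mdot q v.
Proof.
move=> /eqP/wmap_eq0P h; rewrite !mdotE; apply: eq_bigr => l _.
by apply: projE_adj => i j /h /rowP/(_ l); rewrite !mxE.
Qed.

Lemma Mspace_projE C q : Mspace d m q -> Mspace d m (projE C q).
Proof.
move=> /MspaceP h; apply/MspaceP => l; rewrite -[RHS](h l).
have := @projE_adj C q (fun=> 1) l; rewrite !(eq_bigr _ (fun i _ => mulr1 _)).
exact.
Qed.

Lemma Mspace_projI C q : Mspace d m q -> Mspace d m (projI C q).
Proof. by move=> h; apply: MspaceB => //; exact: Mspace_projE. Qed.

Lemma DeltaEP C q : is_part C ->
  DeltaE d m C q <-> Mspace d m q /\ wmap C q = 0.
Proof.
move=> pC; split=> -[Mq h]; split=> //.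
  by apply/eqP/wmap_eq0P => i j /(sameP _ _ pC)[B BC [iB jB]]; exact: h BC iB jB.
move/eqP/wmap_eq0P: h => h B i j BC iB jB; apply: h.
by apply/(sameP _ _ pC); exists B.
Qed.

Lemma mdot_pyth C q :
  mdot q q = mdot (projE C q) (projE C q) + mdot (projI C q) (projI C q).
Proof.
have o : mdot (projI C q) (projE C q) = 0.
  by rewrite mdotBl [X in _ - X]mdot_projE ?wmap_projE // subrr.
have qE : q = projE C q + projI C q by rewrite addrC subrK.
transitivity (mdot (projE C q + projI C q) (projE C q + projI C q)).
  by rewrite -qE.
rewrite mdotDl (mdotDr _ (projE C q) (projI C q)) (mdotDr _ (projE C q) (projI C q)).
by rewrite (mdotC (projE C q) (projI C q)) o addr0 add0r.
Qed.

Lemma mproj_unique (V : set conf) q p : (forall a b, V a -> V b -> V (a - b)) ->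
  V p -> (forall v, V v -> mdot (q - p) v = 0) -> mproj m V q = p.
Proof.
move=> VB Vp op; rewrite /mproj; case: xgetP => [p' _ [Vp' op']|/(_ p)[]//].
have Vd := VB _ _ Vp' Vp; apply/eqP; rewrite -subr_eq0; apply/eqP/mdot_eq0.
rewrite (_ : p' - p = (q - p) - (q - p')) in Vd *.
  by rewrite mdotBl op // op' // subrr.
by apply/matrixP => k l; rewrite !mxE; ring.
Qed.

Lemma qE_projE C q : is_part C -> Mspace d m q -> qE m C q = projE C q.
Proof.
move=> pC Mq; apply: mproj_unique.
- move=> a b /(DeltaEP _ pC)[Ma wa] /(DeltaEP _ pC)[Mb wb].
  by apply/(DeltaEP _ pC); rewrite wmapB wa wb subrr; split=> //; exact: MspaceB.
- by apply/(DeltaEP _ pC); rewrite wmap_projE; split=> //; exact: Mspace_projE.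
- move=> v /(DeltaEP _ pC)[_ wv].
  by rewrite mdotBl mdot_projE // subrr.
Qed.

Lemma DeltaI_projI C q : is_part C -> Mspace d m q -> DeltaI d m C (projI C q).
Proof.
move=> pC Mq; split; first exact: Mspace_projI.
by move=> p /(DeltaEP _ pC)[_ wp]; rewrite mdotBl mdot_projE // subrr.
Qed.

Lemma qI_projI C q : is_part C -> Mspace d m q -> qI m C q = projI C q.
Proof.
move=> pC Mq; apply: mproj_unique.
- move=> a b [Ma oa] [Mb ob]; split; first exact: MspaceB.
  by move=> p hp; rewrite mdotBl oa // ob // subrr.
- exact: DeltaI_projI.
- move=> v [Mv ov]; rewrite /projI opprB addrC subrK mdotC ov //.
  by apply/(DeltaEP _ pC); rewrite wmap_projE; split=> //; exact: Mspace_projE.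
Qed.

Lemma JE_projI C q : is_part C -> Mspace d m q ->
  JE m C q = mdot q q - mnorm (projI C q) ^+ 2.
Proof.
move=> pC Mq; rewrite /JE qE_projE // !mnorm_sqr (mdot_pyth C q).
by rewrite addrK.
Qed.

Lemma projI_Cmin q : projI (Cmin n) q = 0.
Proof.
apply/eqP; rewrite projI_eq0; apply/wmap_eq0P => i j.
by have [_ ->] := Cmin_part n; move=> /eqP->.
Qed.

Lemma SI_wmap_neq0 C u : is_part C -> SI d m C u -> wmap C u != 0.
Proof.
move=> pC [[Mu ou] /= u1]; apply/eqP => w0.
have : mnorm u ^+ 2 = 0 by rewrite mnorm_sqr ou //; apply/(DeltaEP _ pC).
by rewrite u1 expr1n; apply/eqP; rewrite oner_eq0.
Qed.

Lemma MhatP q : Mhat d m q <->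
  Mspace d m q /\ forall C, is_part C -> C != Cmin n -> wmap C q != 0.
Proof.
split=> -[Mq h]; split=> //.
  move=> C pC /(CminNP pC)[i [j [nij ij]]]; apply/eqP => /eqP/wmap_eq0P w0.
  by apply: h; split=> //; exists i, j; split; [exact/eqP | exact: w0].
case=> _ [i [j [/eqP nij ij]]].
(* The partition into groups of coinciding particles is nontrivial and has no deviations at q. *)
pose e : rel 'I_n := [rel a b | row a q == row b q].
have ee : equivalence_rel e by move=> a b c; rewrite /e /= eqxx; split=> // /eqP ->.
have pC := part_of_part ee; have sC := same_part_of ee.
have nm : part_of e != Cmin n.
  by apply/(CminNP pC); exists i, j; rewrite sC /e /= ij.
move/negP: (h _ pC nm); apply.
by apply/wmap_eq0P => a b; rewrite sC => /eqP.
Qed.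

End Projections.

Local Open Scope classical_set_scope.

(** * Homeomorphisms and limits *)

Section Topology.

Lemma within_comp (T U V : topologicalType) (A : set T) (B : set U)
    (f : T -> U) (g : U -> V) : (forall x, A x -> B (f x)) ->
  {within A, continuous f} -> {within B, continuous g} ->
  {within A, continuous (g \o f)}.
Proof.
move=> AB /subspace_continuousP cf /subspace_continuousP cg.
apply/subspace_continuousP => x Ax W /(cg _ (AB _ Ax)).
rewrite /= /within /nbhs /= => h; have := cf x Ax _ h.
by rewrite /nbhs /= /within /=; apply: filterS => y Wy Ay; apply: Wy => //; exact: AB.
Qed.

Lemma homeomorphic_trans (T U V : topologicalType)
    (A : set T) (B : set U) (C : set V) :
  homeomorphic A B -> homeomorphic B C -> homeomorphic A C.
Proof.
move=> [f [g [fA [gB [cf cg]]]]] [h [k [hB [kC [ch ck]]]]].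
exists (h \o f), (g \o k); split; [|split; [|split]].
- by move=> x /fA[/hB[Chf khf] gf]; rewrite /= khf.
- by move=> x /kC[/gB[Agk fgk] hk]; rewrite /= fgk.
- by apply: within_comp cf ch => x /fA[].
- by apply: within_comp ck cg => x /kC[].
Qed.

Lemma continuous_at_within (T U : topologicalType) (A : set T) (f : T -> U) :
  (forall x, A x -> f @ x --> f x) -> {within A, continuous f}.
Proof.
by move=> h; apply: continuous_in_subspaceT => x; rewrite inE => /h.
Qed.

(** Continuity is asked only at x, since the composites of the two maps are controlled only on the
    region and on the blow-up. *)
Lemma fixed_closure (T : topologicalType) (A : set T) (f : T -> T) (x : T) :
  hausdorff_space T -> closure A x -> f @ x --> f x ->
  (forall y, A y -> f y = y) -> f x = x.
Proof.
move=> hT Ax fx fA; apply: hT => U V /fx; rewrite /= nbhs_simpl /= => fU xV.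
have [y [Ay [Uy Vy]]] := Ax _ (filterI fU xV).
by exists y; split=> //; rewrite -(fA _ Ay).
Qed.

Lemma cvg_prod_topology (I T : Type) (U : I -> topologicalType)
    (F : set_system T) (f : T -> prod_topology U) (x : prod_topology U) :
  Filter F -> (forall i, (fun t => f t i) @ F --> x i) -> f @ F --> x.
Proof.
move=> FF h; apply/cvg_sup => i A [_ [[B oB <-] Bx sBA]].
have /h : nbhs (x i) B by rewrite nbhsE; exists B => //; split.
rewrite /nbhs /= => FB; apply: (@filterS _ F _ _ _ _ FB) => t; exact: sBA.
Qed.

Lemma continuous_coord (I : Type) (U : I -> topologicalType) (i : I)
    (x : prod_topology U) : (fun y : prod_topology U => y i) @ x --> x i.
Proof.
have /cvg_sup/(_ i) xi : nbhs x --> x by exact: cvg_id.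
move=> A Axi; apply: xi; move: Axi; rewrite nbhsE => -[B [oB Bx] BA].
by exists [set y : prod_topology U | B (y i)]; split=> //; [exists B | move=> y; exact: BA].
Qed.

Lemma cvg_mx (R : realType) (n d : nat) (T : Type) (F : set_system T)
    (f : T -> 'M[R]_(n, d)) (M : 'M[R]_(n, d)) :
  Filter F -> (forall i j, (fun t => f t i j) @ F --> M i j) -> f @ F --> M.
Proof.
move=> FF h A [P MP sPA]; rewrite /nbhs /=.
have : \forall t \near F, forall i, forall j, P i j (f t i j).
  by apply: filter_forall => i; apply: filter_forall => j; apply: h; exact: MP.
by apply: filterS => t Pt; exact: sPA.
Qed.

Lemma cvg_coord (R : realType) (n d : nat) (T : Type) (F : set_system T)
    (f : T -> 'M[R]_(n, d)) (M : 'M[R]_(n, d)) i j :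
  Filter F -> f @ F --> M -> (fun t => f t i j) @ F --> M i j.
Proof.
move=> FF h; apply: (cvg_comp f (fun N : 'M[R]_(n, d) => N i j) h).
exact: coord_continuous.
Qed.

Lemma cvg_sumr (R : realType) (T : Type) (F : set_system T) (I : Type)
    (r : seq I) (P : pred I) (f : I -> T -> R) (a : I -> R) : Filter F ->
  (forall i, P i -> f i @ F --> a i) ->
  (fun t => \sum_(i <- r | P i) f i t) @ F --> \sum_(i <- r | P i) a i.
Proof. by move=> FF h; apply: cvg_big => //; exact: add_continuous. Qed.

Lemma cvg_bigmax (R : realType) (T : Type) (F : set_system T) (I : Type)
    (r : seq I) (P : pred I) (f : I -> T -> R) (a : I -> R) : Filter F ->
  (forall i, P i -> f i @ F --> a i) ->
  (fun t => \big[Num.max/0]_(i <- r | P i) f i t) @ F -->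
  \big[Num.max/0]_(i <- r | P i) a i.
Proof. by move=> FF h; apply: cvg_big => //; exact: max_continuous. Qed.

Lemma cvg_max (R : realType) (T : Type) (F : set_system T) (f g : T -> R)
    (a b : R) : Filter F -> f @ F --> a -> g @ F --> b ->
  (fun t => Num.max (f t) (g t)) @ F --> Num.max a b.
Proof.
move=> FF fa gb; apply: (continuous2_cvg (h := Num.max) _ _ fa gb).
by have := @max_continuous _ R (a, b).
Qed.

End Topology.

Section Continuity.
Variables (R : realType) (n d : nat) (m : 'I_n -> R).
Variable eps : {set {set 'I_n}} -> R.
Hypothesis n0 : (0 < n)%N.
Hypothesis m_gt0 : forall i, 0 < m i.
Hypothesis eps_gt0 : forall C, 0 < eps C.
Hypothesis eps_lt : forall C D, lep C D -> ~~ lep D C ->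
  4 * n%:R ^+ 2 * eps C < eps D.
Local Notation conf := 'M[R]_(n, d).
Variables (T : Type) (F : set_system T).
Context {FF : Filter F}.
Implicit Types (C D : {set {set 'I_n}}) (f g : T -> conf) (z u : conf).

Lemma cvg_wmap C f z : f @ F --> z -> (fun t => wmap C (f t)) @ F --> wmap C z.
Proof.
move=> h; apply: cvg_mx => k l; rewrite mxE; under eq_fun do rewrite mxE.
by apply: cvgB; exact: cvg_coord.
Qed.

Lemma cvg_cen f z : f @ F --> z -> (fun t => cen m (f t)) @ F --> cen m z.
Proof.
move=> h; apply: cvg_mx => k l; rewrite mxE; under eq_fun do rewrite mxE.
apply: cvgB; first exact: cvg_coord.
apply: cvgM; last exact: cvg_cst.
apply: (@cvg_sumr _ _ _ _ _ _ (fun i t => m i * f t i l)) => i _.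
by apply: cvgM; [exact: cvg_cst | exact: cvg_coord].
Qed.

Lemma cvg_rho C f z : f @ F --> z -> (fun t => rho C (f t)) @ F --> rho C z.
Proof.
move=> h; rewrite rhoE; under eq_fun do rewrite rhoE; apply: cvg_norm.
apply: cvg_mx => k l; rewrite mxE; under eq_fun do rewrite mxE.
apply: cvgM; first exact: cvg_cst.
by apply: cvg_coord; exact: cvg_wmap.
Qed.

Lemma cvg_projE C f z : f @ F --> z ->
  (fun t => projE m C (f t)) @ F --> projE m C z.
Proof.
move=> h; apply: cvg_mx => k l; rewrite mxE; under eq_fun do rewrite mxE.
apply: cvgM; last exact: cvg_cst.
apply: (@cvg_sumr _ _ _ _ _ _ (fun i t => m i * f t i l)) => i _.
by apply: cvgM; [exact: cvg_cst | exact: cvg_coord].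
Qed.

Lemma cvg_projI C f z : f @ F --> z ->
  (fun t => projI m C (f t)) @ F --> projI m C z.
Proof. by move=> h; apply: cvgB => //; exact: cvg_projE. Qed.

Lemma cvg_mnorm f z : f @ F --> z -> (fun t => mnorm m (f t)) @ F --> mnorm m z.
Proof.
move=> h; apply: (cvg_comp (fun t => mdot m (f t) (f t)) Num.sqrt).
  apply: (cvg_sumr (f := fun i t => m i * \sum_k f t i k * f t i k)
    (a := fun i => m i * \sum_k z i k * z i k)) => i _.
  apply: cvgM; first exact: cvg_cst.
  apply: (cvg_sumr (f := fun k t => f t i k * f t i k)
    (a := fun k => z i k * z i k)) => k _.
  by apply: cvgM; exact: cvg_coord.
exact: sqrt_continuous.
Qed.

Lemma cvg_ndir C f z : f @ F --> z -> 0 < rho C z ->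
  (fun t => ndir m C (f t)) @ F --> ndir m C z.
Proof.
move=> h z0; apply: cvgZ; last by apply: cvg_cen; exact: cvg_wmap.
by apply: cvgV; [exact: lt0r_neq0 | exact: cvg_rho].
Qed.

Lemma cvg_sigma C f z : f @ F --> z -> 0 < rho C z ->
  (fun t => sigma m eps C (f t)) @ F --> sigma m eps C z.
Proof.
move=> h z0; apply: cvgB => //; apply: cvgZ; last by apply: cvg_cen; exact: cvg_wmap.
apply: cvgM; last by apply: cvgV; [exact: lt0r_neq0 | exact: cvg_rho].
apply: cvg_max; first exact: cvg_cst.
by apply: cvgB; [exact: cvg_cst | exact: cvg_rho].
Qed.

Lemma cvg_tau C f g z u : f @ F --> z -> g @ F --> u ->
  (fun t => tau eps C (g t) (f t)) @ F --> tau eps C u z.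
Proof.
move=> h hg; apply: cvgD => //; apply: cvgZ => //.
apply: cvg_max; first exact: cvg_cst.
apply: cvgB; first exact: cvg_cst.
by apply: cvgM; [exact: cvg_rho | exact: cvg_cst].
Qed.

(** The predicate covers both the full composition and [below]. Goodness along the unfiltered list
    keeps the denominators [rho D] positive at each contraction. *)
Lemma cvg_Sfold (P : pred {set {set 'I_n}}) l f z : f @ F --> z -> upper l -> good eps l z ->
  (fun t => Sfold m eps [seq C <- l | P C] (f t)) @ F --> Sfold m eps [seq C <- l | P C] z.
Proof.
elim: l f z => //= D l IH f z h ul gz; have [u nl jl] := upper_cons ul.
case: ifP => PD /=; last first.
  by apply: IH => // C Cl; rewrite gz // inE Cl orbT.
apply: (IH (fun t => sigma m eps D (f t))) => //; last exact: good_sigma.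
by apply: cvg_sigma => //; rewrite (lt_le_trans (eps_gt0 D)) // gz ?mem_head.
Qed.

Lemma cvg_Tfold (w : T -> {set {set 'I_n}} -> conf) (w0 : {set {set 'I_n}} -> conf)
    l f z : f @ F --> z ->
  (forall C, C \in l -> (fun t => w t C) @ F --> w0 C) ->
  (fun t => Tfold eps (w t) l (f t)) @ F --> Tfold eps w0 l z.
Proof.
move=> h; elim: l => //= D l IH hw; apply: cvg_tau.
  by apply: IH => C Cl; apply: hw; rewrite inE Cl orbT.
by apply: hw; rewrite mem_head.
Qed.

End Continuity.

(** * The blow-up *)

Section BlowUp.
Variables (R : realType) (n d : nat) (m : 'I_n -> R).
Variable eps : {set {set 'I_n}} -> R.
Hypothesis n2 : (2 <= n)%N.
Hypothesis m_gt0 : forall i, 0 < m i.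
Hypothesis eps_gt0 : forall C, 0 < eps C.
Hypothesis eps_lt : forall C D, lep C D -> ~~ lep D C ->
  4 * n%:R ^+ 2 * eps C < eps D.
Local Notation conf := 'M[R]_(n, d).
Local Notation ambient :=
  (prod_topology (fun _ : PDelta n => (conf * R * conf)%type)).
Implicit Types (C D E : {set {set 'I_n}}) (y z q v : conf) (x : ambient).
Implicit Types (c : PDelta n).

Let n0 : (0 < n)%N. Proof. exact: ltn_trans n2. Qed.

Definition nontrivial_part C := is_part C && (C != Cmin n).

(* Finer partitions come first. *)
Definition partitions : seq {set {set 'I_n}} :=
  sort (fun C D => npairs C <= npairs D)%N (enum nontrivial_part).

Lemma mem_partitions C : (C \in partitions) = nontrivial_part C.
Proof. by rewrite mem_sort mem_enum. Qed.

(** If a later C refined D, its rank would be smaller, against the sorting, unless D also refined C;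
    then C = D, against uniqueness. *)
Lemma upper_partitions : upper partitions.
Proof.
have part_P : all (@is_part n) partitions.
  by apply/allP => C; rewrite mem_partitions => /andP[].
split=> [|C E]; last first.
  rewrite !mem_partitions /nontrivial_part => /andP[pC /(CminNP pC)[i [j [nij ij]]]] pE.
  move=> /lepP CE; rewrite pE; apply/(CminNP pE).
  by exists i, j; split=> //; exact: CE.
have srt : sorted (fun C D : {set {set 'I_n}} => npairs C <= npairs D)%N partitions.
  by apply: sort_sorted => C D; exact: leq_total.
have tr : transitive (fun C D : {set {set 'I_n}} => npairs C <= npairs D)%N.
  by move=> D C E; exact: leq_trans.
have : pairwise [rel C D : {set {set 'I_n}} | (npairs C <= npairs D)%N && (C != D)]
    partitions.
  rewrite pairwise_relI -(sorted_pairwise tr) srt -uniq_pairwise.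
  by rewrite sort_uniq enum_uniq.
apply: sub_in_pairwise part_P => D C pD pC /= /andP[DC nDC].
apply/negP => CD; have [DlC|nDlC] := boolP (lep D C).
  move/eqP: nDC; apply; apply: part_ext => // i j.
  by apply/idP/idP; [move/lepP: DlC; exact | move/lepP: CD; exact].
by have := npairs_lt CD nDlC; rewrite ltnNge DC.
Qed.

Definition pdelta C (CP : nontrivial_part C) : PDelta n :=
  exist (fun C => is_part C && (C != Cmin n)) C CP.

(* Any nontrivial partition would do; it is opaque so that simplification does not
   compute with it. *)
Fact cmax : PDelta n.
Proof.
have e : equivalence_rel (fun _ _ : 'I_n => true) by [].
have pC := part_of_part e; apply: (@pdelta (part_of (fun _ _ => true))).
rewrite /nontrivial_part pC; apply/(CminNP pC).
by exists (Ordinal n0), (Ordinal n2); rewrite same_part_of.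
Qed.

Definition Omega : set conf := Mspace d m `&` [set y | good eps partitions y].

Definition bOmega : set conf :=
  Omega `&` [set y | exists2 C, C \in partitions & rho C y = eps C].

(* Contractions along coarsenings of C only rescale the C-direction, possibly by 0;
   leaving them out, as below does, gives a direction that survives at the
   boundary. *)
Definition Smap y : ambient := fun c =>
  let q := Sfold m eps partitions y in
  let v := Sfold m eps (below (val c) partitions) y in
  (projE m (val c) q, mnorm m (projI m (val c) q),
   (mnorm m (projI m (val c) v))^-1 *: projI m (val c) v).

(** The blow-down: external part plus radius times direction. On the diagonal any factor would give
    the same point. *)
Definition base x : conf := (x cmax).1.1 + (x cmax).1.2 *: (x cmax).2.

(** Converts a direction of unit mass norm into one normalized by [rho C]. The default 0 does not
    occur along [partitions]. *)
Definition dir x C : conf := if insub C is Some c then ndir m C (x c).2 else 0.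

Definition Tmap x : conf := Tfold eps (dir x) partitions (base x).

Lemma valP_part c : is_part (val c). Proof. by case/andP: (valP c). Qed.

Lemma val_partitions c : val c \in partitions.
Proof. by rewrite mem_partitions; exact: (valP c). Qed.

Lemma dir_val x c : dir x (val c) = ndir m (val c) (x c).2.
Proof. by rewrite /dir valK. Qed.

Lemma eq_Tfold (u w : {set {set 'I_n}} -> conf) l q : {in l, u =1 w} ->
  Tfold eps u l q = Tfold eps w l q.
Proof.
elim: l => //= D l IH uw; rewrite uw ?mem_head // IH // => C Cl.
by apply: uw; rewrite inE Cl orbT.
Qed.

Lemma Mspace_Sfold l y : Mspace d m y -> Mspace d m (Sfold m eps l y).
Proof.
elim: l y => //= D l IH y My; apply: IH; rewrite sigmaE; apply: Mspace_lin => //.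
exact: Mspace_cen.
Qed.

Lemma Mspace_Tfold x l q : Mspace d m q -> Mspace d m (Tfold eps (dir x) l q).
Proof.
move=> Mq; elim: l => //= D l IH; apply: Mspace_lin => //.
rewrite /dir; case: insubP => [c _ _|_].
  by apply: MspaceZ; exact: Mspace_cen.
by rewrite -(scale0r q); exact: MspaceZ.
Qed.

Lemma blowup_prod_Mspace x c : blowup_prod d m x ->
  Mspace d m (x c).1.1 /\ Mspace d m (x c).2.
Proof. by move=> /(_ c)[[[? _] _] [[? _] _]]. Qed.

Lemma Mspace_Tmap x : blowup_prod d m x -> Mspace d m (Tmap x).
Proof.
move=> bx; apply: Mspace_Tfold; have [e u] := blowup_prod_Mspace cmax bx.
exact: Mspace_lin.
Qed.

Lemma Smap_dir_gt0 y c : good eps partitions y ->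
  0 < rho (val c) (Sfold m eps (below (val c) partitions) y).
Proof.
move=> gy; apply: lt_le_trans (eps_gt0 (val c)) _.
have up E : is_part E -> lep (val c) E -> eps E <= rho E y.
  by move=> pE cE; apply/gy/(upper_partitions.2 _ _ _ pE cE); exact: val_partitions.
exact: (below_good m n0 eps_gt0 eps_lt upper_partitions gy up (valP_part c) (lep_refl _)).
Qed.

Lemma Smap_dir_neq0 y c : good eps partitions y ->
  projI m (val c) (Sfold m eps (below (val c) partitions) y) != 0.
Proof.
by move=> gy; rewrite (projI_eq0 m_gt0) -rho_gt0 Smap_dir_gt0.
Qed.

Lemma diag_wmap q c : Mhat d m q -> wmap (val c) q != 0.
Proof. by move=> /MhatP[_]; apply; case/andP: (valP c). Qed.

Lemma diagE q c : Mhat d m q -> diag m q c =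
  (projE m (val c) q, mnorm m (projI m (val c) q),
   (mnorm m (projI m (val c) q))^-1 *: projI m (val c) q).
Proof.
move=> [Mq _]; have pc := valP_part c.
by rewrite /diag /to_blowup qE_projE // qI_projI.
Qed.

Lemma base_diag q : Mhat d m q -> base (diag m q) = q.
Proof.
move=> hq; rewrite /base diagE //= scalerA divff ?scale1r.
  by rewrite addrC subrK.
by rewrite (mnorm_eq0 m_gt0) (projI_eq0 m_gt0); exact: diag_wmap.
Qed.

Lemma ndir_normalize C v : wmap C v != 0 ->
  ndir m C ((mnorm m (projI m C v))^-1 *: projI m C v) = ndir m C v.
Proof.
move=> v0; apply: (@ndir_scale _ _ _ _ _ (mnorm m (projI m C v))^-1).
  by rewrite invr_gt0 (mnorm_gt0 m_gt0) (projI_eq0 m_gt0).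
by rewrite wmapZ wmap_projI.
Qed.

Lemma Tmap_diag q : Mhat d m q ->
  Tmap (diag m q) = Tfold eps ((ndir m)^~ q) partitions q.
Proof.
move=> hq; rewrite /Tmap base_diag //; apply: eq_Tfold => C.
rewrite mem_partitions => CP; rewrite -[C]/(val (pdelta CP)).
by rewrite dir_val diagE //= ndir_normalize // (diag_wmap (pdelta CP)).
Qed.

(** The positive factor of [Sfold_dir] cancels on normalization, so the direction found without
    coarsenings is the true direction of the contracted point. *)
Lemma Smap_strict_diag y : Mspace d m y -> sgood eps partitions y ->
  Mhat d m (Sfold m eps partitions y) /\
  Smap y = diag m (Sfold m eps partitions y).
Proof.
move=> My sy; set q := Sfold _ _ _ _.
have wq C : exists2 a, 0 < a &
    wmap C q = a *: wmap C (Sfold m eps (below C partitions) y).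
  by apply: (Sfold_dir m n0 eps_gt0 eps_lt) => //; exact: upper_partitions.
have hq : Mhat d m q.
  apply/MhatP; split=> [|C pC nC]; first exact: Mspace_Sfold.
  have [a a0 ->] := wq C; rewrite scaler_eq0 gt_eqF //=.
  have CP : nontrivial_part C by rewrite /nontrivial_part pC.
  rewrite -rho_gt0; apply: (Smap_dir_gt0 (pdelta CP)).
  exact: sgood_good.
split=> //; apply: functional_extensionality_dep => c; rewrite diagE // /Smap -/q.
have [a a0 /(projI_scale m_gt0) ->] := wq (val c).
congr (_, _, _); rewrite mnormZ gtr0_norm // scalerA invfM mulrAC mulVf ?mul1r //.
by rewrite gt_eqF.
Qed.

Lemma Tmap_Smap_strict y : Mspace d m y -> sgood eps partitions y ->
  Tmap (Smap y) = y.
Proof.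
move=> My sy; have [hq Sy] := Smap_strict_diag My sy.
have {2}<- : Tfold eps (dir (Smap y)) partitions (Sfold m eps partitions y) = y.
  apply: (Tfold_Sfold n0 eps_gt0 eps_lt) => //; first exact: upper_partitions.
    exact: sgood_good.
  move=> C; rewrite mem_partitions => CP.
  rewrite -[C]/(val (pdelta CP)) dir_val /Smap /= ndir_normalize //.
  by rewrite -rho_gt0; apply: (Smap_dir_gt0 (pdelta CP)); exact: sgood_good.
by rewrite /Tmap [in base _]Sy base_diag.
Qed.

Lemma Tmap_diag_strict q : Mhat d m q ->
  sgood eps partitions (Tmap (diag m q)) /\ Smap (Tmap (diag m q)) = diag m q.
Proof.
move=> hq; have [Mq nq] := (MhatP m q).1 hq.
have := @Sfold_Tfold _ _ _ m n0 _ eps_gt0 eps_lt partitions q upper_partitions.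
rewrite -Tmap_diag //; case.
  by move=> C; rewrite mem_partitions => /andP[pC nC]; exact: nq.
move=> sg e; split=> //.
have [|_ ->] := @Smap_strict_diag (Tmap (diag m q)) _ sg; last by rewrite e.
rewrite Tmap_diag // -(eq_Tfold (u := dir (diag m q))); first exact: Mspace_Tfold.
move=> C; rewrite mem_partitions => CP; rewrite -[C]/(val (pdelta CP)).
by rewrite dir_val diagE //= ndir_normalize // (diag_wmap (pdelta CP)).
Qed.

(** * Continuity and extension to the boundary *)

Lemma cvg_Smap y : good eps partitions y -> Smap @ y --> Smap y.
Proof.
move=> gy; apply: (@cvg_prod_topology _ _ _ (nbhs y)) => c; rewrite /Smap.
have up := upper_partitions.
have cq : (fun z => Sfold m eps partitions z) @ y --> Sfold m eps partitions y.
  have := @cvg_Sfold R n d m eps n0 eps_gt0 eps_lt conf (nbhs y) _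
    predT partitions id y cvg_id up gy.
  by rewrite filter_predT; apply.
have cv : (fun z => Sfold m eps (below (val c) partitions) z) @ y -->
    Sfold m eps (below (val c) partitions) y.
  exact: (@cvg_Sfold R n d m eps n0 eps_gt0 eps_lt conf (nbhs y) _
    _ partitions id y cvg_id up gy).
set q := fun z => _ in cq; set v := fun z => _ in cv.
have ce : (fun z => projE m (val c) (q z)) @ y --> projE m (val c) (q y).
  exact: cvg_projE cq.
have cr : (fun z => mnorm m (projI m (val c) (q z))) @ y -->
    mnorm m (projI m (val c) (q y)).
  exact: cvg_mnorm (cvg_projI cq).
have cu : (fun z => (mnorm m (projI m (val c) (v z)))^-1 *: projI m (val c) (v z)) @ y
    --> (mnorm m (projI m (val c) (v y)))^-1 *: projI m (val c) (v y).
  apply: (cvgZ _ (cvg_projI cv)); apply: (cvgV _ (cvg_mnorm (cvg_projI cv))).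
  by rewrite (mnorm_eq0 m_gt0) Smap_dir_neq0.
exact: cvg_pair (cvg_pair ce cr) cu.
Qed.

Lemma blowup_prod_rho_gt0 x c : blowup_prod d m x -> 0 < rho (val c) (x c).2.
Proof.
move=> /(_ c)[_ uS]; rewrite rho_gt0; apply: SI_wmap_neq0 uS => //.
exact: valP_part.
Qed.

Lemma cvg_Tmap x : blowup_prod d m x -> Tmap @ x --> Tmap x.
Proof.
move=> bx; have cx c : (fun x' : ambient => x' c) @ x --> x c.
  exact: continuous_coord.
have cu c : (fun x' : ambient => (x' c).2) @ x --> (x c).2.
  by apply: (cvg_comp _ _ (cx c)); exact: cvg_snd.
have cer c : (fun x' : ambient => (x' c).1) @ x --> (x c).1.
  by apply: (cvg_comp _ _ (cx c)); exact: cvg_fst.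
have ce c : (fun x' : ambient => (x' c).1.1) @ x --> (x c).1.1.
  by apply: (cvg_comp _ _ (cer c)); exact: cvg_fst.
have cr c : (fun x' : ambient => (x' c).1.2) @ x --> (x c).1.2.
  by apply: (cvg_comp _ _ (cer c)); exact: cvg_snd.
apply: (cvg_Tfold (F := nbhs x)) => [|C].
  exact: cvgD (ce cmax) (cvgZ (cr cmax) (cu cmax)).
rewrite mem_partitions => CP; rewrite -[C]/(val (pdelta CP)) dir_val.
have -> : (fun t => dir t (val (pdelta CP))) =
    (fun t => ndir m (val (pdelta CP)) (t (pdelta CP)).2).
  by apply/funext => t; exact: dir_val.
exact: cvg_ndir (cu _) (blowup_prod_rho_gt0 _ bx).
Qed.

Lemma Omega_scale t y : 1 < t -> Omega y ->
  Mspace d m (t *: y) /\ sgood eps partitions (t *: y).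
Proof.
move=> t1 [My gy]; split=> [|C CP]; first exact: MspaceZ.
have t0 : 0 < t by exact: lt_trans t1.
rewrite (@rho_scale _ _ _ C t _ y) ?wmapZ // gtr0_norm //.
apply: lt_le_trans (_ : t * eps C <= _); first by rewrite ltr_pMl.
by rewrite ler_pM2l // gy.
Qed.

(** Dilations by t > 1 make every constraint strict; let t decrease to 1. *)
Lemma closure_strict y : Omega y ->
  closure [set z | Mspace d m z /\ sgood eps partitions z] y.
Proof.
move=> Oy U yU.
have : (fun t : R => t *: y) @ (1 : R)^'+ --> y.
  rewrite -[X in _ --> X]scale1r; apply: cvgZ; last exact: cvg_cst.
  exact: cvg_at_right_filter (@cvg_id _ _).
move=> /(_ _ yU) tU.
have [t [t1 Ut]] : exists t : R, 1 < t /\ U (t *: y).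
  apply: (@filter_ex _ (1 : R)^'+); near=> t; split; last by near: t.
  by near: t; exact: nbhs_right_gt.
by exists (t *: y); split=> //; exact: Omega_scale.
Unshelve. all: by end_near. Qed.

Lemma hausdorff_conf : hausdorff_space conf.
Proof. exact: norm_hausdorff. Qed.

Lemma hausdorff_ambient : hausdorff_space ambient.
Proof.
apply: (@hausdorff_product (PDelta n : eqType)) => c.
exact: norm_hausdorff.
Qed.

Lemma Smap_blowup y : Omega y -> blowup_prod d m (Smap y).
Proof.
move=> [My gy] c; have pc := valP_part c.
have Mq l : Mspace d m (Sfold m eps l y) by exact: Mspace_Sfold.
have u0 := Smap_dir_neq0 c gy.
split; [split|] => /=.
- by apply/DeltaEP => //; rewrite wmap_projE; split=> //; exact: Mspace_projE.
- exact: mnorm_ge0.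
- have [MI oI] := DeltaI_projI m_gt0 pc (Mq (below (val c) partitions)).
  split; [split|]; first exact: MspaceZ.
    by move=> p /oI h; rewrite mdotZl h mulr0.
  rewrite /= mnormZ ger0_norm ?invr_ge0 ?mnorm_ge0 // mulVf //.
  by rewrite (mnorm_eq0 m_gt0).
Qed.

Lemma Smap_MDelta y : Omega y -> MDelta d m (Smap y).
Proof.
move=> Oy; split; first exact: Smap_blowup.
move=> U /(cvg_Smap Oy.2); rewrite /= nbhs_simpl /= => yU.
have [z [[Mz sz] Uz]] := closure_strict Oy yU.
have [hq e] := Smap_strict_diag Mz sz.
by exists (Smap z); split=> //; rewrite e; exists (Sfold m eps partitions z).
Qed.

Lemma Tmap_Smap y : Omega y -> Tmap (Smap y) = y.
Proof.
move=> Oy; apply: (fixed_closure (f := Tmap \o Smap) hausdorff_conf (closure_strict Oy)).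
  apply: (cvg_comp Smap Tmap (cvg_Smap Oy.2)).
  by apply: cvg_Tmap; exact: Smap_blowup.
by move=> z [Mz sz]; exact: Tmap_Smap_strict.
Qed.

Lemma Tmap_Omega x : MDelta d m x -> Omega (Tmap x).
Proof.
move=> [bx cx]; split=> [|C CP]; first exact: Mspace_Tmap.
rewrite leNgt; apply/negP => lt.
have h : (fun x' : ambient => rho C (Tmap x')) @ x --> rho C (Tmap x).
  exact: cvg_rho (cvg_Tmap bx).
have U : nbhs x [set x' | rho C (Tmap x') < eps C] by exact: (cvgr_lt _ h _ lt).
have [_ [[q hq <-]]] := cx _ U; rewrite /= ltNge.
by have [sg _] := Tmap_diag_strict hq; rewrite ltW // sg.
Qed.

Lemma Smap_Tmap x : MDelta d m x -> Smap (Tmap x) = x.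
Proof.
move=> Mx; have [bx cx] := Mx.
apply: (fixed_closure (f := Smap \o Tmap) hausdorff_ambient cx).
  apply: (cvg_comp Tmap Smap (cvg_Tmap bx)).
  exact: cvg_Smap (Tmap_Omega Mx).2.
by move=> _ [q hq <-]; have [_] := Tmap_diag_strict hq.
Qed.

Lemma homeomorphic_bMDelta : homeomorphic bOmega (bMDelta d m).
Proof.
exists Smap, Tmap; split; [|split; [|split]].
- move=> y [Oy [C CP Ce]]; split; last exact: Tmap_Smap.
  split; first exact: Smap_MDelta.
  (* A diagonal image would force y, as its image under [Tmap], to satisfy all constraints
     strictly. *)
  case=> q hq e; have [sg _] := Tmap_diag_strict hq.
  by move: sg; rewrite e Tmap_Smap // => /(_ C CP); rewrite Ce ltxx.
- move=> x [Mx nx]; split; last exact: Smap_Tmap.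
  have Ox := Tmap_Omega Mx; split=> //; apply: contrapT => nb; apply: nx.
  have sg : sgood eps partitions (Tmap x).
    move=> C CP; rewrite lt_neqAle (Ox.2 _ CP) andbT; apply/eqP => e.
    by apply: nb; exists C.
  have [hq e] := Smap_strict_diag Ox.1 sg.
  by exists (Sfold m eps partitions (Tmap x)) => //; rewrite -e Smap_Tmap.
- by apply: continuous_at_within => y [[_ gy] _]; exact: cvg_Smap.
- by apply: continuous_at_within => x [[bx _] _]; exact: cvg_Tmap.
Qed.

End BlowUp.

(** * Radial graphs *)

Section Radial.
Variables (R : realType) (n d : nat) (m : 'I_n -> R).
Hypothesis m_gt0 : forall i, 0 < m i.
Hypothesis n2 : (2 <= n)%N.
Local Notation conf := 'M[R]_(n, d).
Implicit Types (C D : {set {set 'I_n}}) (q y z : conf).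

(** For G of degree -1, [G q *: q] is the only point of the ray of q on the level set G = 1. *)
Lemma homeomorphic_radial (X : set conf) (F G : conf -> R) :
  (forall t q, 0 < t -> X q -> X (t *: q)) ->
  (forall q, X q -> 0 < F q) -> (forall q, X q -> 0 < G q) ->
  (forall t q, 0 < t -> X q -> F (t *: q) = t^-1 * F q) ->
  (forall t q, 0 < t -> X q -> G (t *: q) = t^-1 * G q) ->
  (forall q, X q -> F @ q --> F q) -> (forall q, X q -> G @ q --> G q) ->
  homeomorphic (X `&` [set q | F q = 1]) (X `&` [set q | G q = 1]).
Proof.
move=> Xt F0 G0 Ft Gt Fc Gc.
have half (H K : conf -> R) : (forall q, X q -> 0 < H q) -> (forall q, X q -> 0 < K q) ->
    (forall t q, 0 < t -> X q -> H (t *: q) = t^-1 * H q) ->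
    (forall t q, 0 < t -> X q -> K (t *: q) = t^-1 * K q) ->
    forall q, X q /\ H q = 1 ->
    (X (K q *: q) /\ K (K q *: q) = 1) /\ H (K q *: q) *: (K q *: q) = q.
  move=> H0 K0 Ht Kt q [Xq Hq]; have Kq := K0 _ Xq.
  split; first by split; [exact: Xt | rewrite Kt // mulVf // gt_eqF].
  by rewrite Ht // Hq mulr1 scalerA mulVf ?scale1r // gt_eqF.
exists (fun q => G q *: q), (fun q => F q *: q); split; [|split; [|split]].
- by move=> q Xq; exact: half.
- by move=> q Xq; exact: half.
- apply: continuous_at_within => q [Xq _].
  exact: (cvgZ (Gc _ Xq) (@cvg_id _ (nbhs q))).
- apply: continuous_at_within => q [Xq _].
  exact: (cvgZ (Fc _ Xq) (@cvg_id _ (nbhs q))).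
Qed.

(** The factor by which q must be scaled so that all constraints [a C <= h C] hold with at least one
    equality. Inside the cone the quotients are positive, so the neutral element 0 is harmless. *)
Definition gauge (a : {set {set 'I_n}} -> R)
    (h : {set {set 'I_n}} -> conf -> R) q : R :=
  \big[Num.max/0]_(C | nontrivial_part C) (a C / h C q).

Section Gauge.
Variables (a : {set {set 'I_n}} -> R) (h : {set {set 'I_n}} -> conf -> R).
Hypothesis a_gt0 : forall C, nontrivial_part C -> 0 < a C.
Hypothesis h_gt0 : forall C q, nontrivial_part C -> Mhat d m q -> 0 < h C q.
Hypothesis h_scale : forall C t q, 0 < t -> h C (t *: q) = t * h C q.
Hypothesis h_cvg : forall C q, h C @ q --> h C q.

Lemma gauge_gt0 q : Mhat d m q -> 0 < gauge a h q.
Proof.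
move=> hq; have Pc : nontrivial_part (val (cmax n2)) by exact: (valP (cmax n2)).
apply: (@lt_le_trans _ _ (a (val (cmax n2)) / h (val (cmax n2)) q)).
  by rewrite divr_gt0 ?a_gt0 ?h_gt0.
by apply/bigmax_geP; right; exists (val (cmax n2)).
Qed.

Lemma gauge_scale t q : 0 < t -> gauge a h (t *: q) = t^-1 * gauge a h q.
Proof.
move=> t0; rewrite /gauge; apply: (big_rec2 (fun x y : R => x = t^-1 * y)).
  by rewrite mulr0.
move=> C x y _ ->; rewrite h_scale // invfM mulrCA.
by rewrite maxr_pMr ?invr_ge0 ?ltW // mulr_ge0.
Qed.

Lemma cvg_gauge q : Mhat d m q -> gauge a h @ q --> gauge a h q.
Proof.
move=> hq; apply: (cvg_bigmax (F := nbhs q)) => C PC.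
apply: cvgM; first exact: cvg_cst.
by apply: (cvgV _ (h_cvg (C := C) (q := q))); rewrite gt_eqF // h_gt0.
Qed.

Lemma gauge_eq1 q : Mhat d m q ->
  gauge a h q = 1 <-> (forall C, nontrivial_part C -> a C <= h C q) /\
                      exists2 C, nontrivial_part C & h C q = a C.
Proof.
move=> hq; have h0 C PC := @h_gt0 C q PC hq; split=> [g1|[le_ah [C PC Ce]]].
  have le_ah C : nontrivial_part C -> a C <= h C q.
    move=> PC; rewrite -[h C q]mul1r -ler_pdivrMr ?h0 // -g1.
    by apply/bigmax_geP; right; exists C.
  split=> //; have : 1 <= gauge a h q by rewrite g1.
  case/bigmax_geP => [|[C PC]]; first by rewrite leNgt ltr01.
  rewrite ler_pdivlMr ?h0 // mul1r => ha; exists C => //.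
  by apply/le_anti; rewrite ha le_ah.
apply/le_anti/andP; split.
  apply/bigmax_leP; split=> // D PD; rewrite ler_pdivrMr ?h0 // mul1r.
  exact: le_ah.
by apply/bigmax_geP; right; exists C => //; rewrite Ce divff // gt_eqF // a_gt0.
Qed.

End Gauge.

Lemma MhatZ t q : 0 < t -> Mhat d m q -> Mhat d m (t *: q).
Proof.
move=> t0 /MhatP[Mq nq]; apply/MhatP; split=> [|C pC nC]; first exact: MspaceZ.
by rewrite wmapZ scaler_eq0 negb_or gt_eqF //= nq.
Qed.

Lemma rhoZ C t q : 0 < t -> rho C (t *: q) = t * rho C q.
Proof. by move=> t0; rewrite (rho_scale (wmapZ C t q)) gtr0_norm. Qed.

Lemma mnorm_projIZ C t q : 0 < t ->
  mnorm m (projI m C (t *: q)) = t * mnorm m (projI m C q).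
Proof.
by move=> t0; rewrite (projI_scale m_gt0 (wmapZ C t q)) mnormZ gtr0_norm.
Qed.

Lemma Mhat_rho_gt0 C q : nontrivial_part C -> Mhat d m q -> 0 < rho C q.
Proof. by move=> /andP[pC nC] /MhatP[_ h]; rewrite rho_gt0 h. Qed.

Lemma Mhat_projI_gt0 C q : nontrivial_part C -> Mhat d m q ->
  0 < mnorm m (projI m C q).
Proof.
by move=> /andP[pC nC] /MhatP[_ h]; rewrite (mnorm_gt0 m_gt0) (projI_eq0 m_gt0) h.
Qed.

Lemma cvg_rho_at C q : rho C @ q --> rho C q.
Proof. exact: (cvg_rho (@cvg_id _ (nbhs q))). Qed.

Lemma cvg_mnorm_projI C q :
  (fun z => mnorm m (projI m C z)) @ q --> mnorm m (projI m C q).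
Proof. exact: cvg_mnorm (cvg_projI (@cvg_id _ (nbhs q))). Qed.

Lemma nontrivial_card C : nontrivial_part C -> (#|C| < n)%N.
Proof.
case/andP=> pC /(CminNP pC)[i [j [nij ij]]].
have le_n : (#|C| <= n)%N.
  rewrite (part_blocks pC); apply: leq_trans (leq_imset_card _ _) _.
  by rewrite card_ord.
rewrite ltn_neqAle le_n andbT; apply: contraNneq nij => Cn.
have /imset_injP inj : #|[set [set j | same C i j] | i : 'I_n]%SET| == #|'I_n|.
  by rewrite -(part_blocks pC) Cn card_ord.
by apply/eqP/inj => //; apply/setP => k; rewrite !inE (eq_same ij).
Qed.

Lemma Cmin_card : #|Cmin n| = n.
Proof. by rewrite card_imset ?card_ord //; exact: finset.set1_inj. Qed.

(** * The Graf cell of the finest partition *)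

Section Graf.
Variable delta : R.
Hypothesis delta01 : 0 < delta < 1.

Definition radius C : R := Num.sqrt (delta ^+ #|C| - delta ^+ n).

Lemma radius_gt0 C : nontrivial_part C -> 0 < radius C.
Proof.
move=> PC; have [d0 d1] := andP delta01.
by rewrite sqrtr_gt0 subr_gt0 ltr_iXn2l // nontrivial_card.
Qed.

(** By Pythagoras each [JE] is [mdot q q] minus the squared internal norm. The finest partition has
    n blocks and no internal part, so its maximality bounds every other internal norm from below. *)
Lemma XiP q : Xi d m delta (Cmin n) q <->
  Mspace d m q /\ forall C, nontrivial_part C -> radius C <= mnorm m (projI m C q).
Proof.
have [pm _] := Cmin_part n; have [d0 d1] := andP delta01.
suff e : Mspace d m q -> JE m (Cmin n) q + delta ^+ #|Cmin n| = Jgraf m delta q <->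
    forall C, nontrivial_part C -> radius C <= mnorm m (projI m C q).
  by split=> -[Mq /(e Mq)].
move=> Mq; have JC C : is_part C ->
    JE m C q + delta ^+ #|C| <= JE m (Cmin n) q + delta ^+ #|Cmin n| <->
    delta ^+ #|C| - delta ^+ n <= mnorm m (projI m C q) ^+ 2.
  move=> pC; rewrite !JE_projI // Cmin_card projI_Cmin //.
  rewrite -(scale0r (0 : conf)) mnormZ normr0 mul0r expr0n /= subr0.
  move: (mdot m q q) (delta ^+ #|C|) (delta ^+ n) (mnorm m _ ^+ 2) => a b e r.
  by split; lra.
have rC C : nontrivial_part C ->
    (delta ^+ #|C| - delta ^+ n <= mnorm m (projI m C q) ^+ 2) =
    (radius C <= mnorm m (projI m C q)).
  move=> PC; rewrite -[RHS]ler_sqr ?nnegrE ?mnorm_ge0 ?sqrtr_ge0 //.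
  by rewrite [radius C ^+ 2]sqr_sqrtr // subr_ge0 ler_iXn2l // ltnW // nontrivial_card.
split=> [J C PC|h].
  have pC : is_part C by case/andP: PC.
  rewrite -rC //; apply/JC => //; rewrite J.
  by apply/bigmax_geP; right; exists C.
apply/le_anti/andP; split.
  by apply/bigmax_geP; right; exists (Cmin n).
apply/bigmax_leP; split=> [|C pC].
  by apply: addr_ge0; [exact: sqr_ge0 | rewrite exprn_ge0 // ltW].
have [->|nC] := eqVneq C (Cmin n); first exact: lexx.
have PC : nontrivial_part C by rewrite /nontrivial_part pC.
by apply/JC => //; rewrite rC // h.
Qed.

(** Finitely many strict constraints persist nearby, while a tight one is violated by [t *: q] with
    t < 1 arbitrarily close to 1. *)
Lemma bXiP q : bXi d m delta (Cmin n) q <->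
  [/\ Mspace d m q,
      forall C, nontrivial_part C -> radius C <= mnorm m (projI m C q) &
      exists2 C, nontrivial_part C & mnorm m (projI m C q) = radius C].
Proof.
split=> [[cl nint]|[Mq le_r [C PC Ce]]].
  have Mq : Mspace d m q.
    (* Points off M are isolated in the subspace topology. *)
    apply: contrapT => nM; have : nbhs (q : subspace (Mspace d m)) [set q].
      by case: (@nbhs_subspaceP _ (Mspace d m) q) => // _ z ->.
    by case/cl => z [[Mz _] /= zq]; apply: nM; rewrite -zq.
  have le_r C : nontrivial_part C -> radius C <= mnorm m (projI m C q).
    move=> PC; rewrite leNgt; apply/negP => lt.
    have U : nbhs q [set z | mnorm m (projI m C z) < radius C].
      exact: (cvgr_lt _ (@cvg_mnorm_projI C q) _ lt).
    have : nbhs (q : subspace (Mspace d m)) [set z | mnorm m (projI m C z) < radius C].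
      case: (@nbhs_subspaceP _ (Mspace d m) q) => // _; apply: filterS U => z + _; exact.
    by case/cl => z [/XiP[_ h] /=]; rewrite ltNge h.
  split=> //; apply: contrapT => ne; apply: nint.
  rewrite /interior /=; case: (@nbhs_subspaceP _ (Mspace d m) q) => // _.
  have : \forall z \near nbhs q, forall C, nontrivial_part C ->
      radius C < mnorm m (projI m C z).
    apply: filter_forall => C; have [PC|nPC] := boolP (nontrivial_part C); last first.
      by near=> z.
    have lt : radius C < mnorm m (projI m C q).
      rewrite lt_neqAle le_r // andbT; apply/eqP => e; apply: ne.
      by exists C.
    by apply: filterS (cvgr_gt _ (@cvg_mnorm_projI C q) _ lt) => z h _.
  by apply: filterS => z h Mz; apply/XiP; split=> // C /h/ltW.
split; first by apply: subset_closure; apply/XiP.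
rewrite /interior /=; case: (@nbhs_subspaceP _ (Mspace d m) q) => // _ U.
have : (fun t : R => t *: q) @ (1 : R)^'- --> q.
  rewrite -[X in _ --> X]scale1r; apply: cvgZ; last exact: cvg_cst.
  exact: cvg_at_left_filter (@cvg_id _ _).
move=> /(_ _ U) tU.
have [t [t0 t1 Ut]] : exists t : R, [/\ 0 < t, t < 1 &
    (Mspace d m (t *: q) -> Xi d m delta (Cmin n) (t *: q))].
  apply: (@filter_ex _ (1 : R)^'-); near=> t; split; last by near: t.
    by near: t; exact: nbhs_left_gt.
  by near: t; exact: nbhs_left_lt.
have /XiP[_ /(_ C PC)] := Ut (MspaceZ t Mq).
rewrite mnorm_projIZ // Ce leNgt; apply/negP/negPn.
by rewrite gtr_pMl ?radius_gt0.
Unshelve. all: by end_near. Qed.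

Lemma bXi_gauge : bXi d m delta (Cmin n) =
  Mhat d m `&` [set q | gauge radius (fun C q => mnorm m (projI m C q)) q = 1].
Proof.
have hM q : Mspace d m q ->
    (forall C, nontrivial_part C -> radius C <= mnorm m (projI m C q)) -> Mhat d m q.
  move=> Mq h; apply/MhatP; split=> // C pC nC.
  have PC : nontrivial_part C by rewrite /nontrivial_part pC.
  rewrite -(projI_eq0 m_gt0) -(mnorm_gt0 m_gt0).
  by apply: lt_le_trans (h _ PC); exact: radius_gt0.
apply/seteqP; split=> q.
  case/bXiP => Mq le_r ex; have hq := hM _ Mq le_r; split=> //.
  apply/(gauge_eq1 radius_gt0 Mhat_projI_gt0) => //.
move=> [hq /(gauge_eq1 radius_gt0 Mhat_projI_gt0 hq)[le_r ex]].
by apply/bXiP; split=> //; case: hq.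
Qed.

End Graf.

Lemma bOmega_gauge (eps : {set {set 'I_n}} -> R) : (forall C, 0 < eps C) ->
  bOmega m eps = Mhat d m `&` [set q | gauge eps (@rho R n d) q = 1].
Proof.
move=> e0; have e0' C : nontrivial_part C -> 0 < eps C by [].
apply/seteqP; split=> q.
  case=> -[Mq gq] [C CP Ce]; have hq : Mhat d m q.
    apply/MhatP; split=> // D pD nD; rewrite -rho_gt0.
    apply: lt_le_trans (e0 D) (gq _ _).
    by rewrite mem_partitions /nontrivial_part pD.
  split=> //; apply/(gauge_eq1 e0' Mhat_rho_gt0 hq); split=> [D PD|].
    by apply: gq; rewrite mem_partitions.
  by exists C => //; rewrite -mem_partitions.
case=> hq /(gauge_eq1 e0' Mhat_rho_gt0 hq)[le_r [C PC Ce]].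
split; last by exists C => //; rewrite mem_partitions.
by split; [case: hq | move=> D; rewrite mem_partitions; exact: le_r].
Qed.

Lemma Mhat_neq0 q : Mhat d m q -> q != 0.
Proof.
move=> hq; have := Mhat_rho_gt0 (valP (cmax n2)) hq; rewrite rho_gt0.
by apply: contraNneq => ->; rewrite -[X in wmap _ X](scale0r (0 : conf)) wmapZ scale0r.
Qed.

(** The norm is inverted to get degree -1, as [homeomorphic_radial] requires. *)
Lemma sphere_gauge : Msphere d m `\` Delta d m =
  Mhat d m `&` [set q | (mnorm m q)^-1 = 1].
Proof.
apply/seteqP; split=> q; first by case=> -[Mq q1] nD; split=> //=; rewrite q1 invr1.
case=> -[Mq nD] /= q1; split=> //; split=> //.
by rewrite /= -[LHS]invrK q1 invr1.
Qed.

End Radial.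

Theorem theorem5p3 (R : realType) (n d : nat) (m : 'I_n -> R)
  (hn : (2 <= n)%N) (hd : (1 <= d)%N) (hm : forall i, 0 < m i)
  (delta0 : R) (hdelta0 : 0 < delta0 < 1)
  (hnested : graf_nested d m delta0)
  (delta : R) (hdelta : 0 < delta < delta0) :
  homeomorphic (Msphere d m `\` Delta d m) (bXi d m delta (Cmin n)) /\
  homeomorphic (bXi d m delta (Cmin n)) (bMDelta d m).
Proof.
have delta01 : 0 < delta < 1.
  have [d0 d1] := andP hdelta; have [_ d2] := andP hdelta0.
  by rewrite d0 (lt_trans d1).
have [eps [eps_gt0 eps_lt]] := @exists_scales R n.
have eps_gt0' C : nontrivial_part C -> 0 < eps C by [].
rewrite bXi_gauge //.
have XM t q : 0 < t -> Mhat d m q -> Mhat d m (t *: q) by exact: MhatZ.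
have rg (C : {set {set 'I_n}}) : nontrivial_part C -> 0 < radius delta C.
  exact: radius_gt0.
have pg := @Mhat_projI_gt0 R n d m hm.
have ps C (t : R) (q : 'M[R]_(n, d)) : 0 < t ->
    mnorm m (projI m C (t *: q)) = t * mnorm m (projI m C q).
  exact: (mnorm_projIZ hm).
split.
  rewrite sphere_gauge.
  apply: homeomorphic_radial => //.
  - by move=> q hq; rewrite invr_gt0 (mnorm_gt0 hm) (Mhat_neq0 hn hq).
  - by move=> q hq; exact: (gauge_gt0 hn rg pg hq).
  - by move=> t q t0 hq; rewrite mnormZ gtr0_norm // invfM.
  - by move=> t q t0 hq; exact: (gauge_scale _ ps).
  - move=> q hq; apply: (cvgV _ (cvg_mnorm (@cvg_id _ (nbhs q)))).
    by rewrite (mnorm_eq0 hm) (Mhat_neq0 hn hq).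
  - by move=> q hq; exact: (cvg_gauge pg (@cvg_mnorm_projI R n d m) hq).
have blow := @homeomorphic_bMDelta R n d m eps hn hm eps_gt0 eps_lt.
apply: (homeomorphic_trans _ blow).
rewrite bOmega_gauge //; have rp := @Mhat_rho_gt0 R n d m.
apply: homeomorphic_radial => //.
- by move=> q hq; exact: (gauge_gt0 hn rg pg hq).
- by move=> q hq; exact: (gauge_gt0 hn eps_gt0' rp hq).
- by move=> t q t0 hq; exact: (gauge_scale _ ps).
- by move=> t q t0 hq; apply: gauge_scale => // C s z s0; exact: rhoZ.
- by move=> q hq; exact: (cvg_gauge pg (@cvg_mnorm_projI R n d m) hq).
- by move=> q hq; exact: (cvg_gauge rp (@cvg_rho_at R n d) hq).
Qed.
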